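(* Let $k$ be a field and let $A$ be a commutative local noetherian $k$-algebra with maximal ideal $\mathfrak{m}$. Let $\mathcal{T}$ be $D(A)$ or $D\mathrm{diff}(A)$. Then $A/\mathfrak{m}\notin\langle A\rangle_{\mathcal{T},\operatorname{Krulldim}A}$.
   Context: $D(A)$ is the derived category of $A$-modules. A differential $A$-module is an $(A\otimes_kk[\varepsilon]/(\varepsilon^2))$-module, i.e. a pair $(M,d)$ with $M$ an $A$-module and $d\in\operatorname{End}_A(M)$ with $d^2=0$; its cohomology is $\ker d/\operatorname{im}d$. Differential $A$-modules form a Frobenius exact category, the exact sequences being the exact sequences of $(A\otimes_kk[\varepsilon]/(\varepsilon^2))$-modules that split after restriction to $A$; its stable category is called the homotopy category of differential $A$-modules. $D\mathrm{diff}(A)$ is the localization of this homotopy category at the quasi-isomorphisms (morphisms inducing an isomorphism on cohomology). It is a triangulated category with trivial shift functor. An $A$-module is viewed as a differential module with $d=0$. For a triangulated category $\mathcal{T}$ and a subcategory (or object) $\mathcal{I}$: $\langle\mathcal{I}\rangle$ is the smallest full subcategory containing $\mathcal{I}$ and closed under finite direct sums, direct summands and shifts; $\mathcal{I}_1*\mathcal{I}_2$ is the full subcategory of objects $M$ for which there is a distinguished triangle $M_1\to M\to M_2\to M_1[1]$ with $M_i\in\mathcal{I}_i$; $\mathcal{I}_1\diamond\mathcal{I}_2=\langle\mathcal{I}_1*\mathcal{I}_2\rangle$; $\langle\mathcal{I}\rangle_{\mathcal{T},0}=0$ and $\langle\mathcal{I}\rangle_{\mathcal{T},i}=\langle\mathcal{I}\rangle_{\mathcal{T},i-1}\diamond\langle\mathcal{I}\rangle$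 for $i\ge1$. *)

(* Defs.v *)
From HB Require Import structures.
From mathcomp Require Import all_boot all_order all_algebra.
From mathcomp Require Import ring_quotient.
From mathcomp Require Import boolp classical_sets.

Set Implicit Arguments.
Unset Strict Implicit.
Unset Printing Implicit Defensive.

Import Order.TTheory GRing.Theory Num.Theory.
Local Open Scope ring_scope.

(* [idealr A] is the type of proper ideals of [A]; they are boolean predicates,
   which is no restriction in the presence of the axioms of [boolp].  The unit
   ideal is generated by [1], so [noetherian] need not mention it. *)
Definition noetherian (A : comNzRingType) : Prop :=
  forall I : idealr A, exists s : seq A,
    {subset s <= I} /\
    forall x, x \in I ->
      exists c : 'I_(size s) -> A, x = \sum_i c i * s`_i.

Definition maximal_ideal (A : comNzRingType) (m : idealr A) : Prop :=
  forall I : idealr A, {subset m <= I} -> I =i m.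

Definition local_ring (A : comNzRingType) (m : idealr A) : Prop :=
  maximal_ideal m /\ forall I : idealr A, maximal_ideal I -> I =i m.

Definition prime_chain (A : comNzRingType) (n : nat) : Prop :=
  exists p : 'I_n.+1 -> prime_idealr A,
    forall i j : 'I_n.+1, (i < j)%N ->
      {subset p i <= p j} /\ ~ {subset p j <= p i}.

(* The value is junk (namely [0]) when the lengths of chains of primes are
   unbounded, which does not happen for a noetherian local ring. *)
Definition krull_dim (A : comNzRingType) : nat :=
  xget 0%N [set n | prime_chain A n /\
                    forall l, prime_chain A l -> (l <= n)%N]%classic.

Definition residue (A : comNzRingType) (m : idealr A) : Type := {ideal_quot m}.

HB.instance Definition _ (A : comNzRingType) (m : idealr A) :=
  GRing.ComNzRing.on (residue m).

Section ResidueModule.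
Local Open Scope quotient_scope.
Variables (A : comNzRingType) (m : idealr A).

Definition residue_scale (a : A) (x : residue m) : residue m :=
  (\pi_({ideal_quot m}) a : residue m) * x.

Fact residue_scaleA a b x :
  residue_scale a (residue_scale b x) = residue_scale (a * b) x.
Proof. by rewrite /residue_scale mulrA; congr (_ * _); rewrite !piE. Qed.

Fact residue_scale1 : left_id 1 residue_scale.
Proof.
move=> x; rewrite /residue_scale -[RHS]mul1r.
by congr (_ * _); rewrite !piE.
Qed.

Fact residue_scaleDr : right_distributive residue_scale +%R.
Proof. by move=> a x y; rewrite /residue_scale mulrDr. Qed.

Fact residue_scaleDl x : {morph residue_scale^~ x : a b / a + b}.
Proof.
move=> a b; rewrite /residue_scale -mulrDl.
by congr (_ * _); rewrite !piE.
Qed.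

HB.instance Definition _ := GRing.Zmodule_isLmodule.Build A (residue m)
  residue_scaleA residue_scale1 residue_scaleDr residue_scaleDl.

End ResidueModule.

(* Homs are setoids: [heq] is the equality of morphisms.  Both shifts used below
   satisfy [sh n (sh m X)] isomorphic to [sh (n + m) X]; this is not recorded. *)
Record shCat := ShCat {
  ob :> Type;
  hom : ob -> ob -> Type;
  heq : forall X Y : ob, hom X Y -> hom X Y -> Prop;
  idm : forall X : ob, hom X X;
  comp : forall X Y Z : ob, hom Y Z -> hom X Y -> hom X Z;
  sh : int -> ob -> ob;
  shm : forall (n : int) (X Y : ob), hom X Y -> hom (sh n X) (sh n Y);
  heq_refl : forall X Y (f : hom X Y), heq f f;
  heq_sym : forall X Y (f g : hom X Y), heq f g -> heq g f;
  heq_trans : forall X Y (f g h : hom X Y), heq f g -> heq g h -> heq f h;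
  comp_heq : forall X Y Z (g g' : hom Y Z) (f f' : hom X Y),
    heq g g' -> heq f f' -> heq (comp g f) (comp g' f');
  comp_idl : forall X Y (f : hom X Y), heq (comp (idm Y) f) f;
  comp_idr : forall X Y (f : hom X Y), heq (comp f (idm X)) f;
  compA : forall W X Y Z (h : hom Y Z) (g : hom X Y) (f : hom W X),
    heq (comp h (comp g f)) (comp (comp h g) f);
  shm_heq : forall n X Y (f g : hom X Y), heq f g -> heq (shm n f) (shm n g);
  shm_id : forall n X, heq (shm n (idm X)) (idm (sh n X));
  shm_comp : forall n X Y Z (g : hom Y Z) (f : hom X Y),
    heq (shm n (comp g f)) (comp (shm n g) (shm n f))
}.

Definition is_iso (C : shCat) (X Y : C) (f : hom X Y) : Prop :=
  exists g : hom Y X, heq (comp g f) (idm X) /\ heq (comp f g) (idm Y).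

Section Localization.
Variables (C : shCat) (S : forall X Y : C, hom X Y -> Prop).
Hypothesis S_sh : forall n X Y (s : hom X Y), S s -> S (shm n s).

(* The category obtained by freely inverting the morphisms in [S]: [locHom] are
   formal composites, [locEq] is the congruence generated by the relations of
   the category [C] and by [s^-1 s = 1], [s s^-1 = 1]. *)
Inductive locHom : C -> C -> Type :=
| LocMor X Y : hom X Y -> locHom X Y
| LocInv X Y (s : hom X Y) : S s -> locHom Y X
| LocComp X Y Z : locHom Y Z -> locHom X Y -> locHom X Z.

Inductive locEq : forall X Y, locHom X Y -> locHom X Y -> Prop :=
| LocRefl X Y (f : locHom X Y) : locEq f f
| LocSym X Y (f g : locHom X Y) : locEq f g -> locEq g f
| LocTrans X Y (f g h : locHom X Y) : locEq f g -> locEq g h -> locEq f h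
| LocCongr X Y Z (g g' : locHom Y Z) (f f' : locHom X Y) :
    locEq g g' -> locEq f f' -> locEq (LocComp g f) (LocComp g' f')
| LocIdl X Y (f : locHom X Y) : locEq (LocComp (LocMor (idm Y)) f) f
| LocIdr X Y (f : locHom X Y) : locEq (LocComp f (LocMor (idm X))) f
| LocA W X Y Z (h : locHom Y Z) (g : locHom X Y) (f : locHom W X) :
    locEq (LocComp h (LocComp g f)) (LocComp (LocComp h g) f)
| LocHeq X Y (f g : hom X Y) : heq f g -> locEq (LocMor f) (LocMor g)
| LocMorComp X Y Z (g : hom Y Z) (f : hom X Y) :
    locEq (LocMor (comp g f)) (LocComp (LocMor g) (LocMor f))
| LocInvl X Y (s : hom X Y) (Ss : S s) :
    locEq (LocComp (LocInv Ss) (LocMor s)) (LocMor (idm X))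
| LocInvr X Y (s : hom X Y) (Ss : S s) :
    locEq (LocComp (LocMor s) (LocInv Ss)) (LocMor (idm Y)).

Fixpoint locSh n X Y (f : locHom X Y) : locHom (sh n X) (sh n Y) :=
  match f with
  | LocMor _ _ f => LocMor (shm n f)
  | LocInv _ _ _ Ss => LocInv (S_sh n Ss)
  | LocComp _ _ _ g f => LocComp (locSh n g) (locSh n f)
  end.

Fact locSh_id n X : locEq (locSh n (LocMor (idm X))) (LocMor (idm (sh n X))).
Proof. exact/LocHeq/shm_id. Qed.

Fact locSh_locEq n X Y (f g : locHom X Y) :
  locEq f g -> locEq (locSh n f) (locSh n g).
Proof.
elim=> {X Y f g} /=.
- by move=> *; apply: LocRefl.
- by move=> *; apply: LocSym.
- by move=> X Y f g h _ fg _; apply: LocTrans.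
- by move=> X Y Z g g' f f' _ gg' _; apply: LocCongr.
- move=> X Y f; apply: LocTrans (LocIdl _).
  by apply: LocCongr (LocRefl _); apply: locSh_id.
- move=> X Y f; apply: LocTrans (LocIdr _).
  by apply: LocCongr (LocRefl _) _; apply: locSh_id.
- by move=> *; apply: LocA.
- by move=> *; apply/LocHeq/shm_heq.
- move=> X Y Z g f; apply: LocTrans (LocMorComp _ _).
  exact/LocHeq/shm_comp.
- move=> X Y s Ss; apply: LocTrans (LocInvl _) _.
  by apply: LocSym; apply: locSh_id.
- move=> X Y s Ss; apply: LocTrans (LocInvr _) _.
  by apply: LocSym; apply: locSh_id.
Qed.

Definition localization : shCat :=
  @ShCat C locHom locEq (fun X => LocMor (idm X)) LocComp (@sh C) locSh
    LocRefl LocSym LocTrans LocCongr LocIdl LocIdr LocA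
    locSh_locEq locSh_id (fun n X Y Z g f => LocRefl _).

End Localization.

(* Only the data of a triangulated category are recorded: [gen] does not depend
   on the axioms. *)
Record triCat := TriCat {
  tri_cat :> shCat;
  dist : forall X Y Z : tri_cat,
    hom X Y -> hom Y Z -> hom Z (sh 1 X) -> Prop
}.

(* The distinguished triangles of a Verdier quotient of [C]: those isomorphic to
   the image of a triangle of the given class [T] of triangles of [C]. *)
Definition loc_tri (C : shCat) (S : forall X Y : C, hom X Y -> Prop)
    (S_sh : forall n X Y (s : hom X Y), S X Y s -> S _ _ (shm n s))
    (T : forall X Y Z : C, hom X Y -> hom Y Z -> hom Z (sh 1 X) -> Prop) :
    triCat :=
  @TriCat (localization S_sh) (fun X Y Z u v w =>
    exists (X' Y' Z' : C) (u' : hom X' Y') (v' : hom Y' Z')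
           (w' : hom Z' (sh 1 X')),
      T X' Y' Z' u' v' w' /\
    exists (a : @hom (localization S_sh) X X')
           (b : @hom (localization S_sh) Y Y')
           (c : @hom (localization S_sh) Z Z'),
      [/\ is_iso a, is_iso b & is_iso c] /\
      [/\ heq (comp b u) (comp (LocMor S u' : @hom (localization S_sh) _ _) a),
          heq (comp c v) (comp (LocMor S v' : @hom (localization S_sh) _ _) b)
        & heq (comp (shm 1 a) w)
              (comp (LocMor S w' : @hom (localization S_sh) _ _) c)]).

Section Generation.
Variable T : triCat.
Implicit Types (X Y Z M : T) (I J : T -> Prop).

Definition is_zero Z : Prop :=
  (forall X, exists f : hom Z X, forall g : hom Z X, heq g f) /\
  (forall X, exists f : hom X Z, forall g : hom X Z, heq g f).

(* Direct sums as coproducts, which in an additive category is the same. *)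
Definition is_dsum X Y Z : Prop :=
  exists (iX : hom X Z) (iY : hom Y Z),
    forall W (f : hom X W) (g : hom Y W),
      exists h : hom Z W,
        (heq (comp h iX) f /\ heq (comp h iY) g) /\
        forall h' : hom Z W,
          heq (comp h' iX) f -> heq (comp h' iY) g -> heq h' h.

(* The full subcategory <I>, given by its objects.  It is closed under
   isomorphism, by [add_summand] with a zero complement. *)
Inductive add_closure I : T -> Prop :=
| add_gen X : I X -> add_closure I X
| add_zero X : is_zero X -> add_closure I X
| add_dsum X Y Z :
    is_dsum X Y Z -> add_closure I X -> add_closure I Y -> add_closure I Z
| add_summand X Y Z : is_dsum X Y Z -> add_closure I Z -> add_closure I X
| add_shift n X : add_closure I X -> add_closure I (sh n X).

Definition star I J M : Prop :=
  exists M1 M2 (u : hom M1 M) (v : hom M M2) (w : hom M2 (sh 1 M1)),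
    [/\ I M1, J M2 & dist u v w].

Definition diamond I J : T -> Prop := add_closure (star I J).

Fixpoint gen I (i : nat) : T -> Prop :=
  if i is i'.+1 then diamond (gen I i') (add_closure I) else is_zero.

End Generation.

(* For submodules B of Z in V and B' of Z' in W with f(Z) in Z' and f(B) in B':
   the map Z/B -> Z'/B' induced by f is bijective. *)
Definition subquot_iso (V W : zmodType) (Z B : V -> Prop) (Z' B' : W -> Prop)
    (f : V -> W) : Prop :=
  (forall x, Z x -> B' (f x) -> B x) /\
  (forall y, Z' y -> exists2 x, Z x & B' (y - f x)).

Section Complexes.
Variable A : comNzRingType.

(* Differentials [X i -> X j] are given for all [i] and [j], and vanish unless
   [j = i + 1]; this avoids transports along equalities of indices. *)
Record cplx := Cplx {
  cx :> int -> lmodType A;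
  cd : forall i j, {linear cx i -> cx j};
  cd_shape : forall i j, i + 1 <> j -> forall x, cd i j x = 0;
  cdd : forall i j k x, cd j k (cd i j x) = 0
}.

Record cmap (X Y : cplx) := CMap {
  cm :> forall i, {linear X i -> Y i};
  cm_d : forall i j x, cm j (cd X i j x) = cd Y i j (cm i x)
}.

Definition homotopic (X Y : cplx) (f g : cmap X Y) : Prop :=
  exists h : forall i j, {linear X i -> Y j},
    forall i j k, j + 1 = i -> i + 1 = k -> forall x,
      f i x - g i x = cd Y j i (h i j x) + h k i (cd X i k x).

Definition cm_id (X : cplx) : cmap X X.
Proof. by exists (fun i => idfun). Defined.

Definition cm_comp (X Y Z : cplx) (g : cmap Y Z) (f : cmap X Y) : cmap X Z.
Proof. by exists (fun i => g i \o f i) => i j x /=; rewrite !cm_d. Defined.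

Definition cx_shift (n : int) (X : cplx) : cplx.
Proof.
exists (fun i => X (i + n))
       (fun i j => ((-1) ^+ `|n|%N : A) \*: cd X (i + n) (j + n)).
- move=> i j ij x /=; rewrite cd_shape ?scaler0// => /eqP.
  by rewrite addrAC (inj_eq (addIr n)) => /eqP.
- by move=> i j k x /=; rewrite linearZ/= cdd !scaler0.
Defined.

Definition cm_shift (n : int) (X Y : cplx) (f : cmap X Y) :
  cmap (cx_shift n X) (cx_shift n Y).
Proof.
by exists (fun i => f (i + n)) => i j x /=; rewrite linearZ/= cm_d.
Defined.

Fact homotopic_eq X Y (f g : cmap X Y) : (forall i, f i =1 g i) -> homotopic f g.
Proof.
move=> fg; exists (fun i j => \0) => i j k _ _ x /=.
by rewrite fg subrr linear0 addr0.
Qed.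

Fact homotopic_sym X Y (f g : cmap X Y) : homotopic f g -> homotopic g f.
Proof.
case=> h fg; exists (fun i j => \- h i j) => i j k ij ik x /=.
by rewrite -opprB (fg i j k)// linearN opprD.
Qed.

Fact homotopic_trans X Y (f g h : cmap X Y) :
  homotopic f g -> homotopic g h -> homotopic f h.
Proof.
case=> s fg [t gh]; exists (fun i j => s i j \+ t i j) => i j k ij ik x /=.
rewrite -(subrK (g i x) (f i x)) -addrA (fg i j k)// (gh i j k)//.
by rewrite linearD addrACA.
Qed.

Fact homotopic_comp X Y Z (g g' : cmap Y Z) (f f' : cmap X Y) :
  homotopic g g' -> homotopic f f' -> homotopic (cm_comp g f) (cm_comp g' f').
Proof.
case=> t gg' [s ff']; exists (fun i j => (g j \o s i j) \+ (t i j \o f' i)).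
move=> i j k ij ik x /=.
rewrite -(subrK (g i (f' i x)) (g i (f i x))) -addrA (gg' i j k)//.
rewrite -linearB (ff' i j k)// !linearD/= !cm_d -!addrA; congr (_ + _).
by rewrite addrCA.
Qed.

Fact homotopic_shift n X Y (f g : cmap X Y) :
  homotopic f g -> homotopic (cm_shift n f) (cm_shift n g).
Proof.
case=> h fg.
exists (fun i j => ((-1) ^+ `|n|%N : A) \*: h (i + n) (j + n)).
move=> i j k ij ik x /=; rewrite (fg _ (j + n) (k + n)); first last.
- by rewrite -ik addrAC.
- by rewrite -ij addrAC.
by rewrite !linearZ/= !scalerA -expr2 sqrr_sign !scale1r.
Qed.

Definition cx_homotopy_cat : shCat.
Proof.
apply: (@ShCat cplx cmap homotopic cm_id cm_comp cx_shift cm_shift);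
  try by [move=> *; apply: homotopic_eq].
- exact: homotopic_sym.
- exact: homotopic_trans.
- exact: homotopic_comp.
- exact: homotopic_shift.
Defined.

Definition cocycle (X : cplx) i (x : X i) : Prop := forall j, cd X i j x = 0.

Definition coboundary (X : cplx) i (x : X i) : Prop :=
  exists j (y : X j), cd X j i y = x.

Definition cx_quasi_iso (X Y : cplx) (f : cmap X Y) : Prop :=
  forall i, subquot_iso (@cocycle X i) (@coboundary X i)
                        (@cocycle Y i) (@coboundary Y i) (f i).

Fact cocycle_shift (n : int) (X : cplx) (i : int) (x : X (i + n)) :
  cocycle (x : cx_shift n X i) <-> cocycle x.
Proof.
split=> cx j /=; last by rewrite cx scaler0.
have /= := cx (j - n); rewrite subrK => /(congr1 (fun z => (-1) ^+ `|n|%N *: z)).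
by rewrite scalerA -expr2 sqrr_sign scale1r scaler0.
Qed.

Fact coboundary_shift (n : int) (X : cplx) (i : int) (x : X (i + n)) :
  coboundary (x : cx_shift n X i) <-> coboundary x.
Proof.
split=> [[j [y /= <-]]|[j [y <-]]].
  by exists (j + n), ((-1) ^+ `|n|%N *: y); rewrite linearZ.
move: y; rewrite -(subrK n j) => y; exists (j - n), ((-1) ^+ `|n|%N *: y) => /=.
by rewrite linearZ/= scalerA -expr2 sqrr_sign scale1r.
Qed.

Fact cx_quasi_iso_shift n (X Y : cx_homotopy_cat) (f : hom X Y) :
  cx_quasi_iso f -> cx_quasi_iso (shm n f : cmap _ _).
Proof.
move=> qf i; have [inj sur] := qf (i + n); split=> [x|y].
  by move=> /cocycle_shift cx /coboundary_shift/(inj _ cx)/coboundary_shift.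
move=> /cocycle_shift/sur[x cx bx].
by exists x; [exact/cocycle_shift|exact/coboundary_shift].
Qed.

Definition transp (X : int -> lmodType A) (i j : int) (x : X i) : X j :=
  if i =P j is ReflectT e then ecast k (X k) e x else 0.

Fact transp_id (X : int -> lmodType A) i (x : X i) : transp i x = x.
Proof. by rewrite /transp; case: eqP => // e; rewrite eq_axiomK. Qed.

Fact transp0 (X : int -> lmodType A) i j (x : X i) : i <> j -> transp j x = 0.
Proof. by rewrite /transp; case: eqP. Qed.

Fact transp_linear (X : int -> lmodType A) i j : linear (@transp X i j).
Proof.
move=> a x y; rewrite /transp; case: eqP => [e|]; last by rewrite scaler0 addr0.
by case: _ / e.
Qed.

HB.instance Definition _ (X : int -> lmodType A) i j :=
  GRing.isLinear.Build A (X i) (X j) *:%R (@transp X i j) (@transp_linear X i j).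

Section Cone.
Variables (X Y : cplx) (f : cmap X Y).

Definition cone_cx (i : int) : lmodType A := (Y i * X (i + 1)%R)%type.

Definition cone_d i j (z : cone_cx i) : cone_cx j :=
  (cd Y i j z.1 + transp j (f (i + 1) z.2), - cd X (i + 1) (j + 1) z.2).

Fact cone_d_linear i j : linear (@cone_d i j).
Proof.
move=> a x y; rewrite /cone_d; congr (_, _) => /=.
  by rewrite !linearP/= scalerDr addrACA.
by rewrite linearP/= opprD scalerN.
Qed.

HB.instance Definition _ i j :=
  GRing.isLinear.Build A (cone_cx i) (cone_cx j) *:%R (@cone_d i j)
    (@cone_d_linear i j).

Definition cone : cplx.
Proof.
exists cone_cx (fun i j => @cone_d i j).
- move=> i j ij x /=; rewrite /cone_d cd_shape// transp0// cd_shape ?oppr0 ?addr0//.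
  by move=> /addIr.
- move=> i j k x /=; rewrite /cone_d/=; congr (_, _); last first.
    by rewrite linearN/= cdd !oppr0.
  rewrite linearD/= cdd add0r.
  have [<-|/eqP ij] := eqVneq (i + 1) j; last first.
    by rewrite transp0// linear0 add0r cd_shape ?oppr0 ?linear0// => /addIr.
  rewrite transp_id !linearN/= cm_d.
  have [<-|/eqP jk] := eqVneq (i + 1 + 1) k; first by rewrite transp_id subrr.
  by rewrite transp0// cd_shape// subr0.
Defined.

Definition cone_inl i (y : Y i) : cone i := (y, 0).

Definition cone_prr i (z : cone i) : cx_shift 1 X i := z.2.

Fact cone_inl_linear i : linear (@cone_inl i).
Proof.
by move=> a x y; rewrite /cone_inl; congr (_, _) => /=; rewrite scaler0 addr0.
Qed.

Fact cone_prr_linear i : linear (@cone_prr i).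
Proof. by []. Qed.

HB.instance Definition _ i :=
  GRing.isLinear.Build A (Y i) (cone i) *:%R (@cone_inl i) (@cone_inl_linear i).
HB.instance Definition _ i :=
  GRing.isLinear.Build A (cone i) (cx_shift 1 X i) *:%R (@cone_prr i)
    (@cone_prr_linear i).

Definition cone_in : cmap Y cone.
Proof.
exists (fun i => @cone_inl i) => i j x /=.
by rewrite /cone_d /cone_inl /= !linear0 ?oppr0 addr0.
Defined.

Definition cone_pr : cmap cone (cx_shift 1 X).
Proof.
exists (fun i => @cone_prr i) => i j x /=.
by rewrite /cone_prr /= expr1 scaleN1r.
Defined.

End Cone.

Inductive cone_triangle : forall X Y Z : cx_homotopy_cat,
  hom X Y -> hom Y Z -> hom Z (sh 1 X) -> Prop :=
| ConeTriangle (X Y : cx_homotopy_cat) (f : hom X Y) :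
    @cone_triangle X Y (cone f) f (cone_in f) (cone_pr f).

Definition derived_cat : triCat :=
  loc_tri (C := cx_homotopy_cat) cx_quasi_iso_shift cone_triangle.

Definition stalk (M : lmodType A) : cplx.
Proof.
by exists (fun i : int => if i == 0 then M else 'rV[A]_0) (fun i j => \0).
Defined.

End Complexes.

Section DifferentialModules.
Variable A : comNzRingType.

Record dmod := DMod {
  dm :> lmodType A;
  dd : {linear dm -> dm};
  ddd : forall x, dd (dd x) = 0
}.

Record dmap (X Y : dmod) := DMap {
  dmf :> {linear X -> Y};
  dmf_d : forall x, dmf (dd X x) = dd Y (dmf x)
}.

(* The admissible epimorphisms of the exact structure, i.e. those which split
   over [A]. *)
Definition deflation (X Y : dmod) (p : dmap X Y) : Prop :=
  exists s : {linear Y -> X}, cancel s p.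

Definition projective (P : dmod) : Prop :=
  forall (X Y : dmod) (p : dmap X Y), deflation p ->
  forall f : dmap P Y, exists g : dmap P X, forall x, p (g x) = f x.

(* Equality in the stable category: the difference factors through a
   projective (equivalently, injective) object. *)
Definition stably_eq (X Y : dmod) (f g : dmap X Y) : Prop :=
  exists2 P : dmod, projective P &
  exists (a : dmap X P) (b : dmap P Y), forall x, f x - g x = b (a x).

Definition dmap_id (X : dmod) : dmap X X.
Proof. by exists idfun. Defined.

Definition dmap_comp (X Y Z : dmod) (g : dmap Y Z) (f : dmap X Y) : dmap X Z.
Proof. by exists (g \o f) => x /=; rewrite !dmf_d. Defined.

Definition dmap_opp (X Y : dmod) (f : dmap X Y) : dmap X Y.
Proof. by exists (\- f) => x /=; rewrite dmf_d linearN. Defined.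

(* The underlying module is unchanged by the shift, but the differential gets a
   sign: the cokernel of the admissible monomorphism x |-> (x, dx) from (X, d) to
   the projective-injective object X (x) k[e]/(e^2) is (X, - d). *)
Definition dm_shift (n : int) (X : dmod) : dmod.
Proof.
exists (dm X) (((-1) ^+ `|n|%N : A) \*: dd X) => x /=.
by rewrite linearZ/= ddd !scaler0.
Defined.

Definition dmap_shift (n : int) (X Y : dmod) (f : dmap X Y) :
  dmap (dm_shift n X) (dm_shift n Y).
Proof.
by apply: (@DMap (dm_shift n X) (dm_shift n Y) (dmf f)) => x /=;
  rewrite linearZ/= dmf_d.
Defined.

Definition dmod0 : dmod.
Proof. by exists 'rV[A]_0 \0. Defined.

Fact projective0 : projective dmod0.
Proof.
move=> X Y p _ f; unshelve eexists.
  by exists \0 => x /=; rewrite linear0.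
by move=> x /=; rewrite (thinmx0 x : x = 0) !linear0.
Qed.

Definition dmap0 (X Y : dmod) : dmap X Y.
Proof. by exists \0 => x /=; rewrite linear0. Defined.

Section Sum.
Variables P Q : dmod.

Definition dmod_sum_d (z : dm P * dm Q) : dm P * dm Q := (dd P z.1, dd Q z.2).

Fact dmod_sum_d_linear : linear dmod_sum_d.
Proof. by move=> a x y; rewrite /dmod_sum_d !linearP. Qed.

HB.instance Definition _ :=
  GRing.isLinear.Build A (dm P * dm Q)%type (dm P * dm Q)%type *:%R dmod_sum_d
    dmod_sum_d_linear.

Definition dmod_sum : dmod.
Proof.
by exists (dm P * dm Q)%type dmod_sum_d => x; rewrite /= /dmod_sum_d !ddd.
Defined.

Fact dmap_pair X (f : dmap X P) (g : dmap X Q) :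
  exists h : dmap X dmod_sum, forall x, h x = (f x, g x).
Proof.
have lin : linear (fun x => (f x, g x) : dmod_sum).
  by move=> a x y; rewrite !linearP.
pose H := GRing.isLinear.Build A X dmod_sum *:%R _ lin.
pose h : {linear X -> dmod_sum} := HB.pack (fun x => (f x, g x) : dmod_sum) H.
by unshelve eexists (@DMap X dmod_sum h _) => // x /=;
   rewrite /dmod_sum_d /= !dmf_d.
Qed.

Fact dmap_copair X (f : dmap P X) (g : dmap Q X) :
  exists h : dmap dmod_sum X, forall z, h z = f z.1 + g z.2.
Proof.
have lin : linear (fun z : dmod_sum => f z.1 + g z.2).
  by move=> a x y /=; rewrite !linearP/= scalerDr addrACA.
pose H := GRing.isLinear.Build A dmod_sum X *:%R _ lin.
pose h : {linear dmod_sum -> X} := HB.pack (fun z : dmod_sum => f z.1 + g z.2) H.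
by unshelve eexists (@DMap dmod_sum X h _) => // x /=;
   rewrite /= !dmf_d linearD.
Qed.

End Sum.

Fact projective_sum P Q :
  projective P -> projective Q -> projective (dmod_sum P Q).
Proof.
move=> projP projQ X Y p dp f.
have [i iE] := dmap_pair (dmap_id P) (dmap0 P Q).
have [j jE] := dmap_pair (dmap0 Q P) (dmap_id Q).
have [g gE] := projP _ _ _ dp (dmap_comp f i).
have [h hE] := projQ _ _ _ dp (dmap_comp f j).
have [k kE] := dmap_copair g h.
exists k => -[x y]; rewrite kE linearD gE hE /= iE jE -linearD /=.
by congr (f (_, _)); rewrite ?addr0 ?add0r.
Qed.

Fact signK (V : lmodType A) (n : int) :
  involutive (fun x : V => ((-1) ^+ `|n|%N : A) *: x).
Proof. by move=> x /=; rewrite scalerA -expr2 sqrr_sign scale1r. Qed.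

Fact projective_shift n P : projective P -> projective (dm_shift n P).
Proof.
move=> projP X Y p [s sK] f.
have fd x : f (dd P x) = dd (dm_shift n Y) (f x).
  by have /= <- := dmf_d f x; rewrite linearZ/= signK.
have [g gE] := projP (dm_shift n X) (dm_shift n Y) (dmap_shift n p)
  (ex_intro _ s sK) (@DMap P (dm_shift n Y) (dmf f) fd).
have gd x : g (dd (dm_shift n P) x) = dd X (g x).
  by rewrite /= linearZ/= dmf_d /= signK.
by exists (@DMap (dm_shift n P) X (dmf g) gd).
Qed.

Fact stably_eq_eq X Y (f g : dmap X Y) : f =1 g -> stably_eq f g.
Proof.
move=> fg; exists dmod0; first exact: projective0.
by exists (dmap0 _ _), (dmap0 _ _) => x /=; rewrite fg subrr.
Qed.

Fact stably_eq_sym X Y (f g : dmap X Y) : stably_eq f g -> stably_eq g f.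
Proof.
case=> P projP [a [b fg]]; exists P => //; exists a, (dmap_opp b) => x /=.
by rewrite -fg opprB.
Qed.

Fact stably_eq_trans X Y (f g h : dmap X Y) :
  stably_eq f g -> stably_eq g h -> stably_eq f h.
Proof.
move=> [P projP [a [b fg]]] [Q projQ [c [d gh]]].
exists (dmod_sum P Q); first exact: projective_sum.
have [r rE] := dmap_pair a c; have [s sE] := dmap_copair b d.
by exists r, s => x; rewrite sE rE -fg -gh addrA subrK.
Qed.

Fact stably_eq_comp X Y Z (g g' : dmap Y Z) (f f' : dmap X Y) :
  stably_eq g g' -> stably_eq f f' ->
  stably_eq (dmap_comp g f) (dmap_comp g' f').
Proof.
move=> [P projP [a [b gg']]] [Q projQ [c [d ff']]].
apply: (@stably_eq_trans _ _ _ (dmap_comp g f')).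
  by exists Q => //; exists c, (dmap_comp g d) => x /=; rewrite -ff' linearB.
by exists P => //; exists (dmap_comp a f'), b => x /=; rewrite -gg'.
Qed.

Fact stably_eq_shift n X Y (f g : dmap X Y) :
  stably_eq f g -> stably_eq (dmap_shift n f) (dmap_shift n g).
Proof.
move=> [P projP [a [b fg]]]; exists (dm_shift n P); first exact: projective_shift.
by exists (dmap_shift n a), (dmap_shift n b).
Qed.

Definition dm_homotopy_cat : shCat.
Proof.
apply: (@ShCat dmod dmap stably_eq dmap_id dmap_comp dm_shift dmap_shift);
  try by [move=> *; apply: stably_eq_eq].
- exact: stably_eq_sym.
- exact: stably_eq_trans.
- exact: stably_eq_comp.
- exact: stably_eq_shift.
Defined.

Definition cycle (X : dmod) (x : X) : Prop := dd X x = 0.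

Definition boundary (X : dmod) (x : X) : Prop := exists y, dd X y = x.

Definition dm_quasi_iso (X Y : dmod) (f : dmap X Y) : Prop :=
  subquot_iso (@cycle X) (@boundary X) (@cycle Y) (@boundary Y) f.

Fact cycle_shift (n : int) (X : dmod) (x : X) :
  cycle (x : dm_shift n X) <-> cycle x.
Proof.
rewrite /cycle /=; split=> [dx|->]; last by rewrite scaler0.
by rewrite -[dd X x](@signK _ n) dx scaler0.
Qed.

Fact boundary_shift (n : int) (X : dmod) (x : X) :
  boundary (x : dm_shift n X) <-> boundary x.
Proof.
split=> [[y /= <-]|[y <-]]; exists ((-1) ^+ `|n|%N *: y) => /=.
  by rewrite linearZ.
by rewrite linearZ/= signK.
Qed.

Fact dm_quasi_iso_shift n (X Y : dm_homotopy_cat) (f : hom X Y) :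
  dm_quasi_iso f -> dm_quasi_iso (shm n f : dmap _ _).
Proof.
move=> [inj sur]; split=> [x|y].
  by move=> /cycle_shift cx /boundary_shift/(inj _ cx)/boundary_shift.
move=> /cycle_shift/sur[x cx bx].
by exists x; [exact/cycle_shift|exact/boundary_shift].
Qed.

Section DCone.
Variables (X Y : dmod) (f : dmap X Y).

Definition dcone_d (z : dm Y * dm X) : dm Y * dm X :=
  (dd Y z.1 + f z.2, - dd X z.2).

Fact dcone_d_linear : linear dcone_d.
Proof.
move=> a x y; rewrite /dcone_d; congr (_, _) => /=.
  by rewrite !linearP/= scalerDr addrACA.
by rewrite linearP/= opprD scalerN.
Qed.

HB.instance Definition _ :=
  GRing.isLinear.Build A (dm Y * dm X)%type (dm Y * dm X)%type *:%R dcone_d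
    dcone_d_linear.

(* The pushout of [f] along x |-> (x, dx), cf. [dm_shift]. *)
Definition dcone : dmod.
Proof.
exists (dm Y * dm X)%type dcone_d => x; rewrite /= /dcone_d /=.
congr (_, _); last by rewrite linearN/= ddd !oppr0.
by rewrite linearD/= ddd add0r linearN/= dmf_d subrr.
Defined.

Definition dcone_inl (y : Y) : dcone := (y, 0).

Definition dcone_prr (z : dcone) : dm_shift 1 X := z.2.

Fact dcone_inl_linear : linear dcone_inl.
Proof.
by move=> a x y; rewrite /dcone_inl; congr (_, _) => /=; rewrite scaler0 addr0.
Qed.

Fact dcone_prr_linear : linear dcone_prr.
Proof. by []. Qed.

HB.instance Definition _ :=
  GRing.isLinear.Build A Y dcone *:%R dcone_inl dcone_inl_linear.
HB.instance Definition _ :=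
  GRing.isLinear.Build A dcone (dm_shift 1 X) *:%R dcone_prr dcone_prr_linear.

Definition dcone_in : dmap Y dcone.
Proof.
exists dcone_inl => x /=.
by rewrite /dcone_d /dcone_inl /= !linear0 ?oppr0 addr0.
Defined.

Definition dcone_pr : dmap dcone (dm_shift 1 X).
Proof.
by exists dcone_prr => x /=; rewrite /dcone_prr /= expr1 scaleN1r.
Defined.

End DCone.

Inductive dcone_triangle : forall X Y Z : dm_homotopy_cat,
  hom X Y -> hom Y Z -> hom Z (sh 1 X) -> Prop :=
| DConeTriangle (X Y : dm_homotopy_cat) (f : hom X Y) :
    @dcone_triangle X Y (dcone f) f (dcone_in f) (dcone_pr f).

Definition Ddiff : triCat :=
  loc_tri (C := dm_homotopy_cat) dm_quasi_iso_shift dcone_triangle.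

Definition dm_triv (M : lmodType A) : dmod.
Proof. by exists M \0. Defined.

End DifferentialModules.

(* Main.v *)
From HB Require Import structures.
From mathcomp Require Import all_boot all_order all_algebra.
From mathcomp Require Import ring_quotient ring boolp classical_sets.
Require Import Defs.
Set Implicit Arguments.
Unset Strict Implicit.
Unset Printing Implicit Defensive.
Import GRing.Theory.
Local Open Scope ring_scope.

(** Let [r] be the Krull dimension of [A].  The proof is a ghost lemma.  Let
    [P_0 -> P_1 -> ... -> P_r] be maps between bounded complexes of finite free
    modules, each of which is zero on homology.  For [X] equal to [A], every
    map [H(X (x) P_j) -> H(X (x) P_(j+1))] is zero by assumption, and an
    induction on [i] along the triangles shows that a composite of [i] of these
    maps is zero for every [X] in [<A>_i] ([ghost_lemma]).  So it suffices to
    find maps whose composite is not zero for [X = A/m].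

    Let [F] be the minimal free resolution of [A/m] and let [P_j] be its brutal
    truncation to the degrees [j], ..., [j + r].  The map [P_j -> P_(j+1)]
    drops the component in degree [j], and the other components of a cycle of
    [P_j] are boundaries because [F] is exact and degree [j + r + 1] is now
    present ([win_shift_ghost]).  The composite [P_0 -> P_r] is the identity in
    degree [r] and zero elsewhere.  As [F] is minimal, all differentials of
    [A/m (x) P_j] vanish, so the composite is not zero for [A/m] if [F_r] is
    not zero ([residue_not_vanishes]).  Serre's argument shows that [F_i] is not
    zero for [i] at most the number [n] of minimal generators of [m]
    ([res_nonzero]), and [r <= n] by Krull's height theorem ([height_le]).

    Morphisms of [D(A)] and [Ddiff(A)] are formal zigzags here, and they are
    never computed: the argument only uses the functors [H(- (x) P)], which
    invert quasi-isomorphisms ([tensor_quasi_iso]), hence act on zigzags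
    ([locmap]), and are exact on cones ([tensor_cone_exact]).  Both categories
    are treated at once through their functors to differential modules
    ([model]): the identity for [Ddiff(A)], the product totalization for
    [D(A)]. *)

(** * Ideals and Krull's height theorem *)


Section Ideals.
Variable A : comNzRingType.
Implicit Types (I J K P Q : A -> Prop) (a b c s t x y : A).

Definition subideal I J := forall x, I x -> J x.

Definition isideal I := I 0 /\ forall a x y, I x -> I y -> I (a * x + y).

Definition isprime P :=
  [/\ isideal P, ~ P 1 & forall x y, P (x * y) -> P x \/ P y].

Lemma ideal0 I : isideal I -> I 0. Proof. by case. Qed.

Lemma ideal_mull I a x : isideal I -> I x -> I (a * x).
Proof. by case=> I0 IP Ix; have := IP a x 0 Ix I0; rewrite addr0. Qed.

Lemma ideal_mulr I a x : isideal I -> I x -> I (x * a).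
Proof. by rewrite mulrC; apply: ideal_mull. Qed.

Lemma idealD I x y : isideal I -> I x -> I y -> I (x + y).
Proof. by case=> _ IP Ix Iy; have := IP 1 x y Ix Iy; rewrite mul1r. Qed.

Lemma idealN I x : isideal I -> I x -> I (- x).
Proof. by rewrite -mulN1r; apply: ideal_mull. Qed.

Lemma idealB I x y : isideal I -> I x -> I y -> I (x - y).
Proof. by move=> iI Ix Iy; apply: idealD => //; apply: idealN. Qed.

Lemma ideal_sum I (T : finType) (F : T -> A) :
  isideal I -> (forall i, I (F i)) -> I (\sum_i F i).
Proof.
move=> iI IF; elim/big_ind: _ => //; first exact: ideal0.
by move=> x y Ix Iy; apply: idealD.
Qed.

Definition ideal_add I a x := exists c t, I c /\ x = c + t * a.

Lemma ideal_add_ideal I a : isideal I -> isideal (ideal_add I a).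
Proof.
move=> iI; split; first by exists 0, 0; split; [exact: ideal0 | ring].
move=> b _ _ [c [t [Ic ->]]] [c' [t' [Ic' ->]]].
exists (b * c + c'), (b * t + t'); split; last by ring.
by apply: idealD => //; apply: ideal_mull.
Qed.

Lemma ideal_add_sub I a : subideal I (ideal_add I a).
Proof. by move=> x Ix; exists x, 0; split=> //; ring. Qed.

Lemma ideal_add_gen I a : isideal I -> ideal_add I a a.
Proof. by move=> iI; exists 0, 1; split; [exact: ideal0 | ring]. Qed.

Lemma ideal_add_mono I J a :
  subideal I J -> subideal (ideal_add I a) (ideal_add J a).
Proof. by move=> IJ x [c [t [/IJ Jc ->]]]; exists c, t. Qed.

(** The contraction to [A] of the extension of [I] to the localization at
    the prime [P]; working with it avoids constructing the localization. *)
Definition saturation P I x := exists s, ~ P s /\ I (s * x).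

Definition saturated P I := subideal (saturation P I) I.

Lemma primeMn P s t : isprime P -> ~ P s -> ~ P t -> ~ P (s * t).
Proof. by case=> _ _ pP Ps Pt /pP[]. Qed.

Lemma saturation_sub P I : isprime P -> subideal I (saturation P I).
Proof. by case=> _ P1 _ x Ix; exists 1; rewrite mul1r. Qed.

Lemma saturation_ideal P I : isprime P -> isideal I -> isideal (saturation P I).
Proof.
move=> pP iI; split; first by apply: saturation_sub => //; exact: ideal0.
move=> a x y [s [Ps Isx]] [t [Pt Ity]]; exists (s * t).
split; first exact: primeMn.
have -> : s * t * (a * x + y) = t * a * (s * x) + s * (t * y) by ring.
by apply: idealD => //; apply: ideal_mull.
Qed.

Lemma saturation_saturated P I : isprime P -> saturated P (saturation P I).
Proof.
move=> pP x [s [Ps [t [Pt Itsx]]]]; exists (t * s); rewrite -mulrA.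
by split=> //; apply: primeMn.
Qed.

Lemma saturation_mono P I J :
  subideal I J -> subideal (saturation P I) (saturation P J).
Proof. by move=> IJ x [s [Ps /IJ]]; exists s. Qed.

Section Noetherian.
Hypothesis noethA : noetherian A.

Lemma ideal_fg I : isideal I ->
  exists s : seq A, (forall x, x \in s -> I x) /\
    forall x, I x -> exists c : 'I_(size s) -> A, x = \sum_i c i * s`_i.
Proof.
move=> iI; have [I1|NI1] := pselect (I 1).
  exists [:: 1]; split=> [x _|x _].
    by rewrite -[x]mulr1; apply: ideal_mull.
  by exists (fun=> x); rewrite big_ord1 mulr1.
pose p : pred A := fun x => `[< I x >].
have pcl : idealr_closed p.
  split; first by apply/asboolP; exact: ideal0.
    by apply/asboolPn.
  move=> a x y /asboolP Ix /asboolP Iy; apply/asboolP.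
  by apply: idealD => //; apply: ideal_mull.
pose M := isIdealr.Build A p pcl.
pose Ip : idealr A := HB.pack p M.
have [s [sI gen]] := noethA Ip; exists s; split=> x.
  by move=> /sI /asboolP.
by move=> Ix; apply: gen; apply/asboolP.
Qed.

(** The noetherian condition for families of ideals.  The unit ideal is
    allowed, unlike in [noetherian]. *)
Lemma ideal_max (F : (A -> Prop) -> Prop) :
  (forall I, F I -> isideal I) -> (exists I, F I) ->
  exists2 I, F I & forall J, F J -> subideal I J -> subideal J I.
Proof.
move=> Fid [I0 FI0]; apply: contrapT => nomax.
have next (I : {I | F I}) : exists J : {I | F I},
    subideal (sval I) (sval J) /\ ~ subideal (sval J) (sval I).
  apply: contrapT => no; apply: nomax; exists (sval I); first exact: svalP.
  move=> J FJ IJ; apply: contrapT => NJI.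
  by apply: no; exists (exist _ J FJ).
pose nx (I : {I | F I}) := sval (cid (next I)).
pose c n := iter n nx (exist _ I0 FI0).
have cS n : subideal (sval (c n)) (sval (c n.+1)) by case: (svalP (cid (next (c n)))).
have cN n : ~ subideal (sval (c n.+1)) (sval (c n)).
  by case: (svalP (cid (next (c n)))).
have cle i j : (i <= j)%N -> subideal (sval (c i)) (sval (c j)).
  move=> /subnK <-; elim: (j - i)%N => [|l IHl] x //.
  by move=> /IHl; rewrite addSn; apply: cS.
have idc n : isideal (sval (c n)) by apply: Fid; apply: svalP.
pose U x := exists n, sval (c n) x.
have iU : isideal U.
  split; first by exists 0%N; exact: ideal0.
  move=> a x y [i ix] [j jy]; exists (maxn i j); apply: idealD => //.
    by apply: ideal_mull => //; apply: (cle i) => //; apply: leq_maxl.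
  by apply: (cle j) => //; apply: leq_maxr.
have [s [sU gen]] := ideal_fg iU.
have [n sn] : exists n, forall x, x \in s -> sval (c n) x.
  elim: s sU {gen} => [|y s IHs] sU; first by exists 0%N.
  have [|n sn] := IHs; first by move=> x xs; apply: sU; rewrite inE xs orbT.
  have [|i iy] := sU y; first by rewrite mem_head.
  exists (maxn i n) => x; rewrite inE => /orP[/eqP->|/sn nx'].
    by apply: (cle i) => //; apply: leq_maxl.
  by apply: (cle n) => //; apply: leq_maxr.
apply: (cN n) => x xS; have [|f ->] := gen x; first by exists n.+1.
by apply: ideal_sum => // i; apply: ideal_mull => //; apply/sn/mem_nth.
Qed.

(** An associated prime of [A / J], as in the usual proof that there is one:
    a maximal annihilator of a nonzero element. *)
Lemma assoc_prime J : isideal J -> ~ J 1 ->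
  exists2 a, ~ J a & isprime (fun x => J (x * a)).
Proof.
move=> iJ J1.
have colon a : isideal (fun x => J (x * a)).
  split; first by rewrite mul0r; exact: ideal0.
  by move=> b x y Jx Jy; rewrite mulrDl -mulrA; apply: idealD => //; apply: ideal_mull.
pose F I := exists2 a, ~ J a & I = (fun x => J (x * a)).
have [|| I [a Ja ->] maxa] := @ideal_max F.
- by move=> I [a _ ->].
- by exists (fun x => J (x * 1)), 1.
exists a => //; split=> //; first by rewrite mul1r.
move=> x y Jxya; have [|NJxa] := pselect (J (x * a)); [by left|right].
have /(_ _)/= := maxa (fun z => J (z * (x * a))); apply.
- by exists (x * a).
- by move=> z Jza; rewrite mulrCA; apply: ideal_mull.
- by rewrite mulrCA mulrA.
Qed.

(** If [P] is the only prime between [J0] and [P], the localization of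
    [A / J0] at [P] is artinian.  Noetherian induction: in a maximal
    counterexample [J], some [a] outside [J] is killed by [P], so that a chain
    above [J] meets the simple subquotient spanned by [a] either always or
    only finitely often. *)
Lemma saturated_dcc P J0 (C : nat -> A -> Prop) :
    isprime P -> isideal J0 ->
    (forall Q, isprime Q -> subideal J0 Q -> subideal Q P -> subideal P Q) ->
    (forall n, [/\ isideal (C n), saturated P (C n) & subideal J0 (C n)]) ->
    (forall n, subideal (C n.+1) (C n)) ->
  exists N, forall n, (N <= n)%N -> subideal (C N) (C n).
Proof.
move=> pP iJ0 onlyP C_ok C_desc.
pose desc J (D : nat -> A -> Prop) :=
  (forall n, [/\ isideal (D n), saturated P (D n) & subideal J (D n)]) /\
  (forall n, subideal (D n.+1) (D n)).
pose stab (D : nat -> A -> Prop) :=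
  exists N, forall n, (N <= n)%N -> subideal (D N) (D n).
pose F J := [/\ isideal J, saturated P J, subideal J0 J &
                exists2 D, desc J D & ~ stab D].
suff noF : ~ exists J, F J.
  apply: contrapT => nC; apply: noF; exists (saturation P J0); split.
  - exact: saturation_ideal.
  - exact: saturation_saturated.
  - exact: saturation_sub.
  exists C => //; split=> // n; have [iC sC J0C] := C_ok n; split=> //.
  by move=> x /(saturation_mono J0C)/sC.
move=> exF; have [|J FJ maxJ] := @ideal_max F _ exF; first by move=> J [].
have [iJ sJ J0J [D [Dok Ddesc] nD]] := FJ.
have Dle i j : (i <= j)%N -> subideal (D j) (D i).
  move=> /subnK <-; elim: (j - i)%N => [|l IHl] x //.
  by rewrite addSn => /Ddesc/IHl.
have J1 : ~ J 1.
  move=> J1; apply: nD; exists 0%N => n _ x _.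
  by have [_ _ JD] := Dok n; apply: JD; rewrite -[x]mulr1; apply: ideal_mull.
have [a Ja pa] := assoc_prime iJ J1.
have Pa : forall t, P t -> J (t * a).
  apply: onlyP pa _ _ => [x /J0J Jx|x Jxa]; first exact: ideal_mulr.
  by apply: contrapT => NPx; apply: Ja; apply: sJ; exists x.
have big_stab E : (forall n, E n a) -> desc J E -> stab E.
  move=> Ea [Eok Edesc]; apply: contrapT => nE.
  apply: Ja; apply: (maxJ (saturation P (ideal_add J a))).
  - split.
    + by apply: saturation_ideal => //; apply: ideal_add_ideal.
    + exact: saturation_saturated.
    + by move=> x /J0J Jx; apply: saturation_sub => //; apply: ideal_add_sub.
    exists E => //; split=> // n; have [iE sE JE] := Eok n; split=> // x.
    move=> [s [Ps [c [t [Jc sx]]]]]; apply: sE; exists s; split=> //.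
    by rewrite sx; apply: idealD => //; [exact: JE | exact: ideal_mull].
  - by move=> x Jx; apply: saturation_sub => //; apply: ideal_add_sub.
  - by apply: saturation_sub => //; apply: ideal_add_gen.
have [allD|/existsNP[n1 Dn1]] := pselect (forall n, D n a).
  by apply: nD; apply: big_stab.
pose E n := saturation P (ideal_add (D n) a).
have [|| N EN] := big_stab E.
- move=> n; apply: saturation_sub => //; apply: ideal_add_gen.
  by have [] := Dok n.
- split=> n; last by apply: saturation_mono; apply: ideal_add_mono; apply: Ddesc.
  have [iD _ JD] := Dok n; split.
  + by apply: saturation_ideal => //; apply: ideal_add_ideal.
  + exact: saturation_saturated.
  + by move=> x /JD Dx; apply: saturation_sub => //; apply: ideal_add_sub.
apply: nD; exists (maxn N n1) => n; rewrite geq_max => /andP[Nn n1n] b Db.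
have [iD sD JD] := Dok n; have [iDm _ _] := Dok (maxn N n1).
have [|s [Ps [c [t [Dc sb]]]]] := EN n Nn b.
  apply: saturation_sub => //; apply: ideal_add_sub.
  by apply: Dle Db; apply: leq_maxl.
have [Pt|NPt] := pselect (P t).
  apply: sD; exists s; split=> //; rewrite sb; apply: idealD => //.
  by apply: JD; apply: Pa.
have Dta : D (maxn N n1) (t * a).
  have -> : t * a = s * b - c by rewrite sb; ring.
  apply: idealB => //; first exact: ideal_mull.
  by apply: Dle Dc; rewrite geq_max Nn.
case: Dn1; apply: (Dle _ _ (leq_maxr N n1)).
by have [_ sDm _] := Dok (maxn N n1); apply: sDm; exists t.
Qed.

(** Nakayama's lemma in the localization at [P].  A [P]-saturated ideal
    containing [K], not containing [I] and maximal for this has no [x]-torsion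
    in its quotient.  By maximality, [x * a] then generates [a] over it for
    every [a] in [I], which puts [a] into it because [x] is in [P]. *)
Lemma saturated_nakayama P I K x :
    isprime P -> P x -> isideal I -> isideal K -> saturated P K ->
    (forall a, I a -> exists s c b, [/\ ~ P s, K c, I b & s * a = c + x * b]) ->
  subideal I K.
Proof.
move=> pP Px iI iK sK IK; apply: contrapT => NIK.
pose F L := [/\ isideal L, saturated P L, subideal K L & ~ subideal I L].
have [|| L [iL sL KL NIL] maxL] := @ideal_max F.
- by move=> L [].
- by exists K; split.
have xL a : L (x * a) -> L a.
  move=> Lxa; apply: (maxL (fun a => L (x * a))) => //.
    split.
    - split; first by rewrite mulr0; exact: ideal0.
      move=> b u v Lu Lv; rewrite mulrDr mulrCA.
      by apply: idealD => //; apply: ideal_mull.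
    - by move=> u [s [Ps Lsu]]; apply: sL; exists s; rewrite mulrCA.
    - by move=> u /KL; apply: ideal_mull.
    move=> xI; apply: NIL => u /IK[s [c [b [Ps Kc Ib su]]]]; apply: sL.
    exists s; split=> //; rewrite su; apply: idealD => //; first exact: KL.
    exact: xI.
  by move=> u; apply: ideal_mull.
apply: NIL => a Ia; apply: contrapT => NLa; apply: NLa.
have [|NLxa] := pselect (subideal (saturation P (ideal_add L (x * a))) L).
  move=> h; apply: xL; apply: h; apply: saturation_sub => //.
  exact: ideal_add_gen.
have [s [Ps [c [t [Lc sa]]]]] : saturation P (ideal_add L (x * a)) a.
  apply: contrapT => Na; apply: NLxa; apply: maxL.
    split; [|exact: saturation_saturated| |].
    - by apply: saturation_ideal => //; apply: ideal_add_ideal.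
    - by move=> u /KL Lu; apply: saturation_sub => //; apply: ideal_add_sub.
    - by move=> /(_ a Ia).
  by move=> u Lu; apply: saturation_sub => //; apply: ideal_add_sub.
have [iP _ _] := pP.
apply: sL; exists (s - t * x); split.
  move=> Pd; apply: Ps; rewrite -(subrK (t * x) s); apply: idealD => //.
  exact: ideal_mull.
by have -> : (s - t * x) * a = c by rewrite mulrBl sa; ring.
Qed.

(** Krull's principal ideal theorem.  If no such [Q] exists, [P2] is minimal
    over [P0 + (x)].  For [y] in [P1] but not in [P0], the contractions [C n] of
    [P0 + (y ^+ n)] from the localization at [P1], variants of symbolic powers,
    are then eventually constant by [saturated_dcc] and Nakayama.  This makes
    [y ^+ n] a multiple of [y ^+ n.+1] modulo [P0], up to a factor outside of
    [P1], which is absurd. *)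
Lemma principal_ideal_thm P0 P1 P2 x :
    isprime P0 -> isprime P1 -> isprime P2 ->
    subideal P0 P1 -> ~ subideal P1 P0 -> subideal P1 P2 -> ~ subideal P2 P1 -> P2 x ->
  exists Q, [/\ isprime Q, subideal P0 Q, Q x, subideal Q P2 & ~ subideal P2 Q].
Proof.
move=> pP0 pP1 pP2 P01 NP10 P12 NP21 P2x; apply: contrapT => noQ.
have [iP0 P01' mP0] := pP0; have [iP1 P11 mP1] := pP1; have [iP2 _ _] := pP2.
have NP1x : ~ P1 x by move=> P1x; apply: noQ; exists P1; split.
have [y P1y NP0y] : exists2 y, P1 y & ~ P0 y.
  apply: contrapT => no; apply: NP10 => y P1y; apply: contrapT => NP0y.
  by apply: no; exists y.
pose C n := saturation P1 (ideal_add P0 (y ^+ n)).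
have iC n : isideal (C n) by apply: saturation_ideal => //; apply: ideal_add_ideal.
have sC n : saturated P1 (C n) by exact: saturation_saturated.
have sC2 n : saturated P2 (C n).
  by move=> z [s [P2s Csz]]; apply: sC; exists s; split=> // /P12.
have CS n : subideal (C n.+1) (C n).
  apply: saturation_mono => _ [c [t [P0c ->]]]; exists c, (t * y); split=> //.
  by rewrite exprS; ring.
have P0C n : subideal P0 (C n).
  by move=> z P0z; apply: saturation_sub => //; apply: ideal_add_sub.
pose D n := saturation P2 (ideal_add (C n) x).
have [|Q pQ P0Q QP2|n|n| N DN] := @saturated_dcc P2 (ideal_add P0 x) D pP2.
- exact: ideal_add_ideal.
- apply: contrapT => NP2Q; apply: noQ; exists Q; split=> //.
    by move=> z P0z; apply: P0Q; apply: ideal_add_sub.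
  by apply: P0Q; apply: ideal_add_gen.
- split; [|exact: saturation_saturated|].
    by apply: saturation_ideal => //; apply: ideal_add_ideal.
  by move=> z /(ideal_add_mono (@P0C n)); apply: saturation_sub.
- by apply: saturation_mono; apply: ideal_add_mono; apply: CS.
have CNS : subideal (C N) (C N.+1).
  apply: (@saturated_nakayama P2 (C N) (C N.+1) x) => // a CNa.
  have [|s [P2s [c [b [Cc sa]]]]] := DN N.+1 (leqnSn N) a.
    by apply: saturation_sub => //; apply: ideal_add_sub.
  exists s, c, b; split=> //; last by rewrite sa mulrC.
  apply: sC; exists x; split=> //.
  have -> : x * b = s * a - c by rewrite sa; ring.
  by apply: idealB => //; [exact: ideal_mull | exact: CS].
have [|s [P1s [c [t [P0c sy]]]]] := CNS (y ^+ N).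
  by apply: saturation_sub => //; apply: ideal_add_gen.
have : P0 (y ^+ N * (s - t * y)).
  have -> : y ^+ N * (s - t * y) = s * y ^+ N - t * y ^+ N.+1.
    by rewrite exprS; ring.
  by rewrite sy addrK.
case/mP0=> [P0yN|/P01 P1d].
  elim: N P0yN {DN CNS sy} => [|N IHN]; first by rewrite expr0.
  by rewrite exprS => /mP0[].
apply: P1s; rewrite -(subrK (t * y) s); apply: idealD => //.
exact: ideal_mull.
Qed.

(** Chains of primes are described from the top, which is where the principal
    ideal theorem modifies them. *)
Fixpoint chain_below J (r : nat) P : Prop :=
  if r is r'.+1 then
    isprime P /\ exists Q, [/\ subideal Q P, ~ subideal P Q & chain_below J r' Q]
  else isprime P /\ subideal J P.

Lemma chain_below_prime J r P : chain_below J r P -> isprime P.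
Proof. by case: r => [|r] []. Qed.

(** Going down from the top, a prime without [x] is replaced by a prime with
    [x] that still lies strictly between its neighbours.  Only the last prime
    of the chain has no neighbour below, and is lost. *)
Lemma chain_below_add J r P x :
    isideal J -> P x -> chain_below J r.+1 P ->
  chain_below (ideal_add J x) r P.
Proof.
move=> iJ; elim: r P => [|r IHr] P Px [pP [Q [QP NPQ chQ]]].
  split=> // _ [c [t [Jc ->]]]; have [iP _ _] := pP; have [_ JQ] := chQ.
  by apply: idealD => //; [apply/QP/JQ | exact: ideal_mull].
have [pQ [Q' [QQ' NQQ' chQ']]] := chQ.
have [Qx|NQx] := pselect (Q x).
  by split=> //; exists Q; split=> //; apply: IHr.
have pQ' := chain_below_prime chQ'.
have [R [pR Q'R Rx RP NPR]] := principal_ideal_thm pQ' pQ pP QQ' NQQ' QP NPQ Px.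
split=> //; exists R; split=> //; apply: IHr => //; split=> //.
by exists Q'; split=> // RQ'; apply: NQx; apply: QQ'; apply: RQ'.
Qed.

(** Krull's height theorem, for generators of [P] itself: add them one by one
    to the ideal below the chain; no prime strictly below [P] contains
    them all. *)
Lemma height_le P n (x : 'I_n -> A) r :
    (forall i, P (x i)) -> (forall a, P a -> exists c : 'I_n -> A,
      a = \sum_i c i * x i) ->
  chain_below (fun a => a = 0) r P -> (r <= n)%N.
Proof.
move=> Px genP ch; rewrite leqNgt; apply/negP => nr.
suff [J [iJ Jx chJ]] : exists J,
    [/\ isideal J, forall i, J (x i) & chain_below J (r - n) P].
  move: chJ; case: (r - n)%N (subn_gt0 n r) => [|d _ [_ [Q [QP NPQ ch']]]].
    by rewrite nr.
  apply: NPQ => a /genP[c ->].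
  have [iQ _ _] := chain_below_prime ch'.
  apply: ideal_sum => // i; apply: ideal_mull => //.
  elim: d Q {QP} ch' iQ => [Q [_ JQ] _|d IHd Q]; first exact: JQ.
  move=> [_ [Q' [Q'Q _ ch']]] _; apply: Q'Q; apply: IHd => //.
  by case: (chain_below_prime ch').
suff /(_ n (leqnn n))[J [iJ Jx chJ]] : forall k, (k <= n)%N -> exists J,
    [/\ isideal J, forall i : 'I_n, (i < k)%N -> J (x i) &
        chain_below J (r - k) P].
  by exists J; split=> // i; apply: Jx.
elim=> [_|k IHk kn].
  exists (fun a => a = 0); split; rewrite ?subn0//.
  by split=> // a u v -> ->; rewrite mulr0 addr0.
have [|J [iJ Jx chJ]] := IHk; first exact: ltnW.
exists (ideal_add J (x (Ordinal kn))); split.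
- exact: ideal_add_ideal.
- move=> i; rewrite ltnS leq_eqVlt => /orP[/eqP ik|/Jx].
    by have -> : i = Ordinal kn by [apply: val_inj]; apply: ideal_add_gen.
  exact: ideal_add_sub.
- apply: chain_below_add => //.
  by rewrite -subSn ?subSS//; apply: ltnW; apply: leq_ltn_trans nr.
Qed.

End Noetherian.
End Ideals.

(** * The minimal resolution of the residue field *)


Section LocalRing.
Variables (A : comNzRingType) (m : idealr A).
Hypotheses (noethA : noetherian A) (localA : local_ring m).

Lemma isideal_idealr (I : idealr A) : isideal (fun x => x \in I).
Proof.
split; first exact: idealr0.
by move=> a x y Ix Iy; apply: rpredD => //; apply: idealMr.
Qed.

Lemma proper_sub_max I x : isideal I -> ~ I 1 -> I x -> x \in m.
Proof.
move=> iI I1 Ix; pose F J := [/\ isideal J, ~ J 1 & subideal I J].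
have [||M [iM M1 IM] maxM] := @ideal_max _ noethA F; first by move=> J [].
  by exists I; split.
pose p : pred A := fun x => `[< M x >].
have pcl : idealr_closed p.
  split; first by apply/asboolP; exact: ideal0.
    by apply/asboolPn.
  move=> a u v /asboolP Mu /asboolP Mv; apply/asboolP.
  by apply: idealD => //; apply: ideal_mull.
pose mixin := isIdealr.Build A p pcl.
pose Mp : idealr A := HB.pack p mixin.
have [_ uniq] := localA.
rewrite -(uniq Mp); first by apply/asboolP; apply: IM.
move=> J MJ y; apply/idP/idP => [Jy|/MJ//].
apply/asboolP; apply: (maxM (fun x => x \in J)) => //.
  split; [exact: isideal_idealr|by rewrite idealr1|].
  by move=> u /IM Mu; apply: MJ; apply/asboolP.
by move=> u Mu; apply: MJ; apply/asboolP.
Qed.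

Lemma notin_max_unit a : a \notin m -> exists b, b * a = 1.
Proof.
move=> ma; apply: contrapT => Na; case/negP: ma.
apply: (@proper_sub_max (ideal_add (fun x => x = 0) a)).
- apply: ideal_add_ideal.
  by split=> // b u v -> ->; rewrite mulr0 addr0.
- by move=> [c [t [-> e]]]; apply: Na; exists t; rewrite e add0r.
- by exists 0, 1; rewrite mul1r add0r.
Qed.

Lemma max_prime : isprime (fun x => x \in m).
Proof.
split; [exact: isideal_idealr|by rewrite idealr1|] => x y xy.
have [mx|/notin_max_unit[b bx]] := boolP (x \in m); [by left|right].
by rewrite -[y]mul1r -bx -mulrA; apply: idealMr.
Qed.

(** Induction on [n]: generators of the ideal of first coordinates, and
    generators of the elements with first coordinate zero. *)
Lemma submod_fg n (W : 'rV[A]_n -> Prop) :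
    W 0 -> (forall a u v, W u -> W v -> W (a *: u + v)) ->
  exists p (G : 'M_(p, n)), forall v, W v <-> exists w, v = w *m G.
Proof.
elim: n W => [|n IHn] W W0 WP.
  exists 0%N, 0 => v; split=> [_|_]; first by exists 0; rewrite [LHS]thinmx0 mul0mx.
  by rewrite [v]thinmx0.
pose I a := exists2 v, W v & v 0 0 = a.
have iI : isideal I.
  split; first by exists 0; rewrite ?mxE.
  move=> a _ _ [u Wu <-] [v Wv <-]; exists (a *: u + v); first exact: WP.
  by rewrite !mxE.
have [s [sI gen]] := ideal_fg noethA iI.
have /choice[f fP] : forall i : 'I_(size s), exists v, W v /\ v 0 0 = s`_i.
  by move=> i; have [|v] := sI s`_i; [exact: mem_nth | exists v].
pose W' (u : 'rV_n) := W (row_mx (0 : 'rV_1) u).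
have [||p [G' G'P]] := IHn W'.
- by rewrite /W' row_mx0.
- move=> a u v; rewrite /W' => Wu Wv.
  have -> : row_mx 0 (a *: u + v) = a *: row_mx 0 u + row_mx 0 v :> 'rV_(1 + n).
    by rewrite scale_row_mx add_row_mx scaler0 addr0.
  exact: WP.
pose V : 'M_(_, 1 + n) := \matrix_i f i.
have Wsum q (w : 'rV_q) (M : 'M_(q, 1 + n)) : (forall i, W (row i M)) -> W (w *m M).
  move=> WM; rewrite mulmx_sum_row; elim/big_ind: _ => // [x y Wx Wy|i _].
    by have := WP 1 _ _ Wx Wy; rewrite scale1r.
  by rewrite -[X in W X]addr0; apply: WP.
have mulE (w1 : 'rV_(size s)) (w2 : 'rV_p) :
    row_mx w1 w2 *m col_mx V (row_mx (0 : 'cV_p) G') =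
    w1 *m V + row_mx (0 : 'rV_1) (w2 *m G').
  by rewrite mul_row_col mul_mx_row mulmx0.
exists (size s + p)%N, (col_mx V (row_mx (0 : 'cV_p) G')) => v; split.
  move=> Wv; have [|c vc] := gen (v 0 0); first by exists v.
  pose w1 : 'rV_(size s) := \row_i c i.
  pose v' : 'rV_(1 + n) := v - w1 *m V.
  have v'0 : v' 0 0 = 0.
    rewrite !mxE vc; apply/eqP; rewrite subr_eq0; apply/eqP.
    by apply: eq_bigr => i _; rewrite !mxE; have [_ ->] := fP i.
  have Wv' : W v'.
    rewrite /v' addrC -scaleN1r; apply: WP => //; apply: Wsum => i.
    by rewrite rowK; have [] := fP i.
  have v'E : v' = row_mx 0 (rsubmx v').
    rewrite -[LHS]hsubmxK; congr row_mx; apply/rowP => i.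
    rewrite !mxE ord1 -[RHS]v'0 [in RHS]/v' !mxE.
    by have -> : lshift n 0 = 0 :> 'I_(1 + n) by apply: val_inj.
  have [] := (G'P (rsubmx v')).1; first by rewrite /W' -v'E.
  move=> w2 w2E; exists (row_mx w1 w2).
  by rewrite mulE -w2E -v'E addrC subrK.
move=> [w ->]; rewrite -[w]hsubmxK mulE -[X in X + _]scale1r; apply: WP.
  by apply: Wsum => i; rewrite rowK; have [] := fP i.
by apply/G'P; exists (rsubmx w).
Qed.

(** A generating family with the least number of elements is minimal in the
    sense that its relations have coefficients in the maximal ideal. *)
Lemma submod_min_gens n (W : 'rV[A]_n -> Prop) :
    W 0 -> (forall a u v, W u -> W v -> W (a *: u + v)) ->
  exists p (G : 'M_(p, n)), (forall v, W v <-> exists w, v = w *m G) /\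
    (forall w : 'rV_p, w *m G = 0 -> forall j, w 0 j \in m).
Proof.
move=> W0 WP; pose ok p := exists G : 'M_(p, n), forall v, W v <-> exists w, v = w *m G.
have exP : exists p, `[< ok p >].
  by have [p [G GP]] := submod_fg W0 WP; exists p; apply/asboolP; exists G.
case: (ex_minnP exP) => p /asboolP[G GP] minp; exists p, G; split=> // w wG j.
apply/negPn/negP => /notin_max_unit[b bw].
case: p G GP minp w wG j bw => [|p] G GP minp w wG j bw; first by case: j {bw}.
have row'_mul (u : 'rV_p.+1) : u 0 j = 0 -> u *m G = col' j u *m row' j G.
  move=> uj; apply/rowP => k; rewrite !mxE (bigD1_ord j)//= uj mul0r add0r.
  by apply: eq_bigr => i _; rewrite !mxE.
have /minp : `[< ok p >]; last by rewrite ltnn.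
apply/asboolP; exists (row' j G) => v; split=> [/GP[u ->]|[u ->]].
  exists (col' j (u - (u 0 j * b) *: w)); rewrite -row'_mul.
    by rewrite mulmxBl -scalemxAl wG scaler0 subr0.
  by rewrite !mxE -mulrA bw mulr1 subrr.
apply/GP; pose u' : 'rV_p.+1 :=
  \row_k (if unlift j k is Some i then u 0 i else 0).
exists u'; rewrite row'_mul; last by rewrite mxE unlift_none.
by congr (_ *m _); apply/rowP => k; rewrite !mxE liftK.
Qed.

(** The ranks of a resolution that starts with [A] in degree 0. *)
Definition rk (n : nat -> nat) i := if i is j.+1 then n j else 1%N.

(** The minimal free resolution of the residue field.  The column [d 0] lists
    minimal generators of [m]; the last clause is minimality, and it forces
    all entries of the differentials into [m]. *)
Lemma minimal_resolution :
  exists (n : nat -> nat) (d : forall i, 'M[A]_(rk n i.+1, rk n i)),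
  [/\ forall a, a \in m <-> exists w : 'rV_(rk n 1), a = (w *m d 0%N) 0 0,
      forall i (v : 'rV_(rk n i.+1)),
        v *m d i = 0 <-> exists w : 'rV_(rk n i.+2), v = w *m d i.+1 &
      forall i (w : 'rV_(rk n i.+1)), w *m d i = 0 -> forall j, w 0 j \in m].
Proof.
have [||n0 [d0 [d0P d0m]]] := @submod_min_gens 1 (fun v => v 0 0 \in m).
- by rewrite mxE idealr0.
- move=> a u v mu mv; rewrite !mxE; apply: rpredD => //; exact: idealMr.
have step p q (M : 'M[A]_(p, q)) : exists p' (G : 'M[A]_(p', p)),
    (forall v : 'rV_p, v *m M = 0 <-> exists w : 'rV_p', v = w *m G) /\
    (forall w : 'rV_p', w *m G = 0 -> forall j, w 0 j \in m).
  apply: (@submod_min_gens p (fun v => v *m M = 0)); first by rewrite mul0mx.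
  by move=> a u v uM vM; rewrite mulmxDl -scalemxAl uM vM scaler0 addr0.
pose st := {p : nat & {q : nat & 'M[A]_(p, q)}}.
pose p_ (s : st) := projT1 s; pose q_ (s : st) := projT1 (projT2 s).
pose M_ (s : st) : 'M_(p_ s, q_ s) := projT2 (projT2 s).
pose nx (s : st) : st :=
  existT _ (sval (cid (step _ _ (M_ s))))
   (existT _ (p_ s) (sval (cid (svalP (cid (step _ _ (M_ s))))))).
have nxP s :
    (forall v : 'rV__, v *m M_ s = 0 <-> exists w : 'rV__, v = w *m M_ (nx s)) /\
    (forall w : 'rV__, w *m M_ (nx s) = 0 -> forall j, w 0 j \in m).
  exact: (svalP (cid (svalP (cid (step _ _ (M_ s)))))).
pose s0 : st := existT _ n0 (existT _ 1%N d0).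
pose s_ i := iter i nx s0.
pose n i := p_ (s_ i).
pose d i : 'M[A]_(rk n i.+1, rk n i) :=
  match i with 0%N => d0 | j.+1 => M_ (s_ j.+1) end.
exists n, d; split.
- move=> a; split=> [ma|[w ->]]; last by apply/d0P; exists w.
  have [|w /(congr1 (fun v : 'rV_1 => v 0 0))] := (d0P (\row_(_ < 1) a)).1.
    by rewrite mxE.
  by rewrite mxE; exists w.
- by case=> [|i]; [have [] := nxP s0 | have [] := nxP (s_ i.+1)].
- by case=> [|i]; [exact: d0m | have [] := nxP (s_ i)].
Qed.

Section Resolution.
Variables (n : nat -> nat) (d : forall i, 'M[A]_(rk n i.+1, rk n i)).
Hypothesis d0P : forall a,
  a \in m <-> exists w : 'rV_(rk n 1), a = (w *m d 0%N) 0 0.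
Hypothesis d_exact : forall i (v : 'rV_(rk n i.+1)),
  v *m d i = 0 <-> exists w : 'rV_(rk n i.+2), v = w *m d i.+1.
Hypothesis d_min : forall i (w : 'rV_(rk n i.+1)),
  w *m d i = 0 -> forall j, w 0 j \in m.

Lemma res_dd i : d i.+1 *m d i = 0.
Proof.
apply/row_matrixP => j; rewrite row_mul row0; apply/d_exact.
by exists (delta_mx 0 j); rewrite -rowE.
Qed.

Lemma res_entries i a b : d i a b \in m.
Proof.
case: i a b => [|i] a b.
  apply/d0P; exists (delta_mx 0 a); rewrite -rowE mxE.
  by congr (d 0%N _ _); rewrite [b]ord1.
have : row a (d i.+1) *m d i = 0 by rewrite -row_mul res_dd row0.
by move/d_min => /(_ b); rewrite mxE.
Qed.

Lemma res_lift i q (B : 'M[A]_(q, rk n i.+1)) :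
  B *m d i = 0 -> exists C, B = C *m d i.+1.
Proof.
move=> Bd; have /choice[f fP] : forall j, exists w, row j B = w *m d i.+1.
  by move=> j; apply/d_exact; rewrite -row_mul Bd row0.
exists (\matrix_j f j); apply/row_matrixP => j.
by rewrite row_mul rowK.
Qed.

(** An element of the maximal ideal kills the residue field, hence acts by a
    null-homotopic map on its resolution. *)
Lemma res_homotopy x : x \in m ->
  exists h : forall i, 'M[A]_(rk n i, rk n i.+1),
    h 0%N *m d 0%N = x%:M /\
    forall i, h i.+1 *m d i.+1 + d i *m h i = x%:M.
Proof.
move=> /d0P[w xw].
have w0 : w *m d 0%N = x%:M by apply/matrixP => i j; rewrite !ord1 -xw mxE eqxx.
pose ok i (h : 'M[A]_(rk n i, rk n i.+1)) := d i *m h *m d i = x *: d i.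
have step i (h : {h | @ok i h}) : exists h' : 'M[A]_(rk n i.+1, rk n i.+2),
    h' *m d i.+1 + d i *m sval h = x%:M.
  case: h => h /= hP; have [|h' h'E] := @res_lift i _ (x%:M - d i *m h).
    by rewrite mulmxBl hP mul_scalar_mx subrr.
  by exists h'; rewrite -h'E subrK.
have stepok i h : @ok i.+1 (sval (cid (step i h))).
  have := svalP (cid (step i h)); set h' := sval _; move=> h'E.
  have e : h' *m d i.+1 = x%:M - d i *m sval h by rewrite -h'E addrK.
  by rewrite /ok -mulmxA e mulmxBr mulmxA res_dd mul0mx subr0 mul_mx_scalar.
have ok0 : ok 0%N w by rewrite /ok -mulmxA w0 mul_mx_scalar.
pose h := fix h i : {h | @ok i h} :=
  match i with
  | 0%N => exist _ w ok0
  | j.+1 => exist _ (sval (cid (step j (h j)))) (stepok j (h j))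
  end.
exists (fun i => sval (h i)); split=> // i.
exact: (svalP (cid (step i (h i)))).
Qed.

Lemma max_coeffs q (B : 'I_q -> A) : (forall j, B j \in m) ->
  exists c : 'I_(n 0%N) -> 'I_q -> A,
    forall j, B j = \sum_l d 0%N l 0 * c l j.
Proof.
move=> mB.
have /choice[f fP] : forall j, exists w : 'rV_(rk n 1), B j = (w *m d 0%N) 0 0.
  by move=> j; apply/d0P.
exists (fun l j => f j 0 l) => j; rewrite fP mxE.
by apply: eq_bigr => l _; rewrite mulrC.
Qed.

(** Serre's bound for the Betti numbers of the residue field.  Writing
    [d i = \sum_l x_l *: D l i] for the minimal generators [x_l] of [m], the
    homotopies [h j] and the coefficients [D l] satisfy the relations
    [h j D l + D l h j = (l == j)] of a Clifford algebra modulo [m].  Hence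
    [D i] maps the product of [h 0], ..., [h i] to that of [h 0], ..., [h i.-1]
    modulo [m], and none of these products is zero modulo [m]. *)
Lemma res_nonzero s : (s <= n 0%N)%N ->
  exists z : 'rV[A]_(rk n s), exists j, z 0 j \notin m.
Proof.
have [x xE] : exists x : 'I_(n 0%N) -> A, forall l, d 0%N l 0 = x l.
  by exists (fun l => d 0%N l 0).
have exh (l : 'I_(n 0%N)) : exists h : forall i, 'M[A]_(rk n i, rk n i.+1),
    h 0%N *m d 0%N = (x l)%:M /\
    forall i, h i.+1 *m d i.+1 + d i *m h i = (x l)%:M.
  by apply: res_homotopy; rewrite -xE; apply: res_entries.
pose h l := sval (cid (exh l)).
have hP l : h l 0%N *m d 0%N = (x l)%:M /\
    forall i, h l i.+1 *m d i.+1 + d i *m h l i = (x l)%:M.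
  exact: svalP (cid (exh l)).
have exD i : exists D : 'I_(n 0%N) -> 'M[A]_(rk n i.+1, rk n i),
    d i = \sum_l x l *: D l.
  have /choice[c cP] : forall a, exists c : 'I_(n 0%N) -> 'I_(rk n i) -> A,
      forall b, d i a b = \sum_l x l * c l b.
    move=> a; have [|c cP] := @max_coeffs _ (d i a); first exact: res_entries.
    by exists c => b; rewrite cP; apply: eq_bigr => l _; rewrite xE.
  exists (fun l => \matrix_(a, b) c a l b); apply/matrixP => a b.
  by rewrite cP summxE; apply: eq_bigr => l _; rewrite !mxE.
pose D i := sval (cid (exD i)).
have DE i : d i = \sum_l x l *: D i l by exact: svalP (cid (exD i)).
(* Relations between minimal generators of [m] have coefficients in [m]. *)
have x_min (c : 'I_(n 0%N) -> A) :
    \sum_l x l * c l = 0 -> forall l, c l \in m.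
  move=> c0 l; have /d_min/(_ l) : (\row_l c l) *m d 0%N = 0.
    apply/rowP => j; rewrite !mxE -[RHS]c0; apply: eq_bigr => k _.
    by rewrite mxE mulrC ord1 xE.
  by rewrite mxE.
have sum_delta (F : 'I_(n 0%N) -> A) (j : 'I_(n 0%N)) t :
    \sum_l x l * (F l - (l == j)%:R *+ t) =
    \sum_l x l * F l - x j *+ t.
  rewrite (eq_bigr _ (fun l _ => mulrBr _ _ _)) sumrB; congr (_ - _).
  rewrite (bigD1 j)//= eqxx big1 ?addr0 ?mulrnAr ?mulr1// => l /negPf->.
  by rewrite mul0rn mulr0.
have entryB q (M : 'M[A]_q) c a b : (M - c%:M) a b = M a b - c *+ (a == b).
  by rewrite mxE; congr (_ + _); rewrite !mxE.
have entryS q (c : A) (a b : 'I_q) : c%:M a b = c *+ (a == b) by rewrite mxE.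
have rel0 j l a b : (h j 0%N *m D 0%N l - (l == j)%:R%:M) a b \in m.
  have [e _] := hP j; rewrite entryB; move: l; apply: x_min.
  rewrite sum_delta -entryS -e DE mulmx_sumr summxE.
  apply/eqP; rewrite subr_eq0; apply/eqP; apply: eq_bigr => l _.
  by rewrite -scalemxAr [RHS]mxE.
have relS i j l a b :
    (h j i.+1 *m D i.+1 l + D i l *m h j i - (l == j)%:R%:M) a b \in m.
  have [_ /(_ i) e] := hP j; rewrite entryB; move: l; apply: x_min.
  rewrite sum_delta -entryS -e !DE mulmx_sumr mulmx_suml -big_split /=.
  rewrite summxE; apply/eqP; rewrite subr_eq0; apply/eqP; apply: eq_bigr => l _.
  by rewrite -scalemxAr -scalemxAl -scalerDr [RHS]mxE.
have mulm p q (u : 'rV[A]_p) (M : 'M_(p, q)) :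
    (forall j, u 0 j \in m) -> forall b, (u *m M) 0 b \in m.
  move=> um b; rewrite mxE; apply: rpred_sum => j _.
  by rewrite mulrC; apply: idealMr.
have mulm' p q (u : 'rV[A]_p) (M : 'M_(p, q)) :
    (forall a b, M a b \in m) -> forall b, (u *m M) 0 b \in m.
  move=> Mm b; rewrite mxE; apply: rpred_sum => j _; exact: idealMr.
(* The invariant of the construction: the [D l] which belong to generators that
   have not been used yet kill the product modulo [m]. *)
pose killed i : 'rV[A]_(rk n i) -> Prop :=
  match i return 'rV[A]_(rk n i) -> Prop with
  | 0%N => fun=> True
  | k.+1 => fun z => forall l : 'I_(n 0%N), (k < l)%N ->
              forall b, (z *m D k l) 0 b \in m
  end.
have key i z (j l : 'I_(n 0%N)) : killed i z -> (i <= l)%N ->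
    forall b, (z *m h j i *m D i l - (l == j)%:R *: z) 0 b \in m.
  case: i z => [|i] z zD il b.
    have := mulm' _ _ z _ (rel0 j l) b.
    by rewrite mulmxBr mulmxA mul_mx_scalar.
  have := mulm' _ _ z _ (relS i j l) b.
  rewrite mulmxBr mulmxDr !mulmxA mul_mx_scalar => h1.
  have h2 := mulm _ _ _ (h j i) (zD l il) b.
  have -> : z *m h j i.+1 *m D i.+1 l - (l == j)%:R *: z =
      z *m h j i.+1 *m D i.+1 l + z *m D i l *m h j i - (l == j)%:R *: z -
      z *m D i l *m h j i.
    by rewrite [RHS]addrAC addrK.
  by rewrite mxE; apply: rpredD => //; rewrite mxE rpredN.
suff /(_ s) main : forall i, (i <= n 0%N)%N -> exists z : 'rV[A]_(rk n i),
    (exists j, z 0 j \notin m) /\ killed i z.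
  by move=> /main[z [zm _]]; exists z.
elim=> [_|i IHi lt_i].
  by exists 1%:M; split=> //; exists 0; rewrite mxE eqxx idealr1.
have [|z [[c zc] zD]] := IHi; first exact: ltnW.
pose j := Ordinal lt_i; exists (z *m h j i); split.
  apply: contrapT => no; case/negP: zc.
  have z'm b : (z *m h j i) 0 b \in m.
    by apply: contrapT => /negP z'b; apply: no; exists b.
  have -> : z = z *m h j i *m D i j - (z *m h j i *m D i j - z) by rewrite subKr.
  rewrite mxE; apply: rpredD; first exact: mulm.
  rewrite mxE rpredN; have := key i z j j zD (leqnn i) c.
  by rewrite eqxx scale1r.
move=> l il b; have := key i z j l zD (ltnW il) b.
have -> : (l == j) = false by apply/negP => /eqP lj; move: il; rewrite lj ltnn.
by rewrite scale0r subr0.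
Qed.

End Resolution.
End LocalRing.

(** * Tensor products with bounded complexes of free modules *)


Section Homologous.
Variable A : comNzRingType.

Definition homologous (X : dmod A) (x y : X) := boundary (x - y).

Lemma homologous_refl (X : dmod A) (x : X) : homologous x x.
Proof. by exists 0; rewrite linear0 subrr. Qed.

Lemma homologous_eq (X : dmod A) (x y : X) : x = y -> homologous x y.
Proof. by move=> ->; apply: homologous_refl. Qed.

Lemma homologous_sym (X : dmod A) (x y : X) : homologous x y -> homologous y x.
Proof. by move=> [w ww]; exists (- w); rewrite linearN ww opprB. Qed.

Lemma homologous_trans (X : dmod A) (y x z : X) :
  homologous x y -> homologous y z -> homologous x z.
Proof.
move=> [u uu] [v vv]; exists (u + v).
by rewrite linearD uu vv addrA subrK.
Qed.

Lemma homologousD (X : dmod A) (x y x' y' : X) :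
  homologous x y -> homologous x' y' -> homologous (x + x') (y + y').
Proof.
move=> [u uu] [v vv]; exists (u + v).
by rewrite linearD uu vv opprD addrACA.
Qed.

Lemma homologous_map (X Y : dmod A) (f : dmap X Y) (x y : X) :
  homologous x y -> homologous (f x) (f y).
Proof. by move=> [w ww]; exists (f w); rewrite -dmf_d ww linearB. Qed.

Lemma homologous0 (X : dmod A) (x : X) : homologous x 0 <-> boundary x.
Proof. by rewrite /homologous subr0. Qed.

Lemma boundary_homologous (X : dmod A) (x y : X) :
  homologous x y -> boundary y -> boundary x.
Proof.
move=> xy /homologous0 y0; apply/homologous0; exact: homologous_trans xy y0.
Qed.

Lemma boundaryD (X : dmod A) (x y : X) :
  boundary x -> boundary y -> boundary (x + y).
Proof. by move=> [u <-] [v <-]; exists (u + v); rewrite linearD. Qed.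

Lemma boundary_map (X Y : dmod A) (f : dmap X Y) (x : X) :
  boundary x -> boundary (f x).
Proof. by move=> [w <-]; exists (f w); rewrite dmf_d. Qed.

Lemma cycleD (X : dmod A) (x y : X) : cycle x -> cycle y -> cycle (x + y).
Proof. by rewrite /cycle linearD => -> ->; rewrite addr0. Qed.

Lemma cycle_map (X Y : dmod A) (f : dmap X Y) (x : X) : cycle x -> cycle (f x).
Proof. by rewrite /cycle -dmf_d => ->; rewrite linear0. Qed.

Lemma boundary_cycle (X : dmod A) (x : X) : boundary x -> cycle x.
Proof. by move=> [w <-]; rewrite /cycle ddd. Qed.

Definition dhomotopic (X Y : dmod A) (f g : dmap X Y) : Prop :=
  exists h : {linear X -> Y}, forall x, f x - g x = dd Y (h x) + h (dd X x).

End Homologous.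

(** A bounded complex of finite free modules, as a graded basis and the matrix
    of the differential; the homological degree gives the signs and makes the
    filtration arguments possible. *)
Record ffcplx (A : comNzRingType) := FFCplx {
  ff_ix : finType;
  ff_deg : ff_ix -> nat;
  ff_mx : ff_ix -> ff_ix -> A;
  ff_mx_deg : forall a b, ff_mx a b != 0 -> ff_deg a = (ff_deg b).+1;
  ff_mxK : forall a c, \sum_b ff_mx a b * ff_mx b c = 0
}.

Record ffmap (A : comNzRingType) (P Q : ffcplx A) := FFMap {
  fm_mx :> ff_ix P -> ff_ix Q -> A;
  fm_mx_deg : forall a b, fm_mx a b != 0 -> ff_deg a = ff_deg b;
  fm_comm : forall a c, \sum_b fm_mx a b * ff_mx b c = \sum_b ff_mx a b * fm_mx b c
}.

Section Act.
Variables (A : comNzRingType) (V W : lmodType A).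

Definition act (I J : finType) (M : I -> J -> A) (z : {ffun I -> V}) :
  {ffun J -> V} := [ffun b => \sum_a M a b *: z a].

Lemma act_linear (I J : finType) (M : I -> J -> A) : linear (act M).
Proof.
move=> c x y; apply/ffunP => b; rewrite !ffunE scaler_sumr -big_split /=.
by apply: eq_bigr => a _; rewrite !ffunE scalerDr !scalerA mulrC.
Qed.

HB.instance Definition _ (I J : finType) (M : I -> J -> A) :=
  GRing.isLinear.Build A {ffun I -> V} {ffun J -> V} *:%R (act M) (act_linear M).

Lemma act_comp (I J K : finType) (M : I -> J -> A) (N : J -> K -> A) z :
  act N (act M z) = act (fun a c => \sum_b M a b * N b c) z.
Proof.
apply/ffunP => c; rewrite !ffunE.
under eq_bigr do rewrite ffunE scaler_sumr.
rewrite exchange_big /=; apply: eq_bigr => a _.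
by rewrite scaler_suml; apply: eq_bigr => b _; rewrite scalerA mulrC.
Qed.

Lemma eq_act (I J : finType) (M N : I -> J -> A) z : M =2 N -> act M z = act N z.
Proof.
by move=> MN; apply/ffunP => c; rewrite !ffunE; apply: eq_bigr => b _; rewrite MN.
Qed.

Definition pointwise (I : finType) (f : V -> W) (z : {ffun I -> V}) :
  {ffun I -> W} := [ffun a => f (z a)].

Lemma pointwise_linear (I : finType) (f : {linear V -> W}) :
  linear (@pointwise I f).
Proof. by move=> c x y; apply/ffunP => b; rewrite !ffunE linearP. Qed.

HB.instance Definition _ (I : finType) (f : {linear V -> W}) :=
  GRing.isLinear.Build A {ffun I -> V} {ffun I -> W} *:%R (@pointwise I f)
    (pointwise_linear f).

End Act.

Lemma act_pointwise (A : comNzRingType) (V W : lmodType A) (I J : finType)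
    (M : I -> J -> A) (f : {linear V -> W}) z :
  act M (pointwise f z) = pointwise f (act M z).
Proof.
apply/ffunP => b; rewrite !ffunE linear_sum; apply: eq_bigr => a _.
by rewrite ffunE linearZ.
Qed.

Section Tensor.
Variables (A : comNzRingType) (P : ffcplx A).
Notation I := (ff_ix P).

Definition sgn (a : I) : A := (-1) ^+ ff_deg a.

Lemma sgnK a : sgn a * sgn a = 1.
Proof. by rewrite /sgn -expr2 sqrr_sign. Qed.

Section Obj.
Variable X : dmod A.

Definition twist (z : {ffun I -> X}) : {ffun I -> X} := [ffun a => sgn a *: z a].

Lemma twist_linear : linear twist.
Proof.
by move=> c x y; apply/ffunP => b; rewrite !ffunE scalerDr !scalerA mulrC.
Qed.

HB.instance Definition _ :=
  GRing.isLinear.Build A {ffun I -> X} {ffun I -> X} *:%R twist twist_linear.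

Lemma act_twist z : act (@ff_mx A P) (twist z) = - twist (act (@ff_mx A P) z).
Proof.
apply/ffunP => b; rewrite !ffunE scaler_sumr -sumrN; apply: eq_bigr => a _.
rewrite ffunE !scalerA -scaleNr; congr (_ *: _).
have [->|/ff_mx_deg e] := eqVneq (ff_mx a b) 0; first by rewrite mul0r mulr0 oppr0.
by rewrite /sgn e exprS; ring.
Qed.

(** The signs make the differential of [X] and that of [P] anticommute. *)
Definition tensor_d (z : {ffun I -> X}) : {ffun I -> X} :=
  twist (pointwise (dd X) z) + act (@ff_mx A P) z.

Lemma tensor_d_linear : linear tensor_d.
Proof. by move=> c x y; rewrite /tensor_d !linearP/= scalerDr addrACA. Qed.

HB.instance Definition _ :=
  GRing.isLinear.Build A {ffun I -> X} {ffun I -> X} *:%R tensor_d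
    tensor_d_linear.

Definition tensor : dmod A.
Proof.
exists {ffun I -> X} tensor_d => z; rewrite /= /tensor_d !linearD /=.
rewrite act_twist act_pointwise addrA addrK act_comp.
have -> : act (fun a c => \sum_b ff_mx a b * ff_mx b c) z = 0.
  apply/ffunP => b; rewrite !ffunE big1// => a _; rewrite ff_mxK scale0r//.
rewrite addr0; apply/ffunP => a; rewrite !ffunE linearZ /= ddd.
by rewrite !scaler0.
Defined.

End Obj.

Section Maps.
Variables (X Y : dmod A).

Lemma tensor_map_d (f : dmap X Y) (z : tensor X) :
  pointwise f (dd (tensor X) z) = dd (tensor Y) (pointwise f z).
Proof.
rewrite /= /tensor_d linearD /= -act_pointwise; congr (_ + _).
by apply/ffunP => a; rewrite !ffunE linearZ /= dmf_d.
Qed.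

Definition tensor_map (f : dmap X Y) : dmap (tensor X) (tensor Y) :=
  @DMap A (tensor X) (tensor Y) (@pointwise A X Y I f) (tensor_map_d f).

Lemma tensor_homotopic (f g : dmap X Y) z :
  dhomotopic f g -> cycle z -> homologous (tensor_map f z) (tensor_map g z).
Proof.
move=> [h fg] cz; exists (twist (pointwise h z)).
have <- : dd (tensor Y) (twist (pointwise h z)) +
    twist (pointwise h (dd (tensor X) z)) =
    tensor_map f z - tensor_map g z.
  rewrite /= /tensor_d act_twist act_pointwise !linearD /= addrA addrAC subrK.
  apply/ffunP => a; rewrite !ffunE fg !linearZ /= !scalerA sgnK !scale1r//.
by rewrite cz !linear0 addr0.
Qed.

End Maps.

(** Induction on the degree: the component of highest degree of a cycle is a
    cycle, and can be removed by subtracting a boundary. *)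
Lemma tensor_acyclic (X : dmod A) :
  (forall x : X, cycle x -> boundary x) ->
  forall z : tensor X, cycle z -> boundary z.
Proof.
move=> acX z.
(* [N] exceeds the degrees where [z] is not zero. *)
pose N := (\max_(a : I) ff_deg a).+1.
have zN a : (N <= ff_deg a)%N -> z a = 0.
  by move=> Na; have := leq_bigmax (F := @ff_deg A P) a; rewrite leqNgt Na.
elim: N z zN => [|N IHN] z zN cz.
  have -> : z = 0 by apply/ffunP => a; rewrite zN// ffunE.
  by exists 0; rewrite linear0.
have /choice[w wP] : forall a, exists w,
    if ff_deg a == N then dd X w = sgn a *: z a else w = 0.
  move=> a; case: eqP => [aN|_]; last by exists 0.
  have [|w ww] := acX (z a).
    have /ffunP/(_ a) := cz; rewrite !ffunE big1 ?addr0; last first.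
      move=> b _; have [->|/ff_mx_deg e] := eqVneq (ff_mx b a) 0.
        by rewrite scale0r.
      by rewrite zN ?scaler0// e aN.
    by move=> /(congr1 (fun x => sgn a *: x)); rewrite scalerA sgnK scale1r scaler0.
  by exists (sgn a *: w); rewrite linearZ ww.
pose w' : tensor X := [ffun a => w a].
have [u uE] : boundary (z - dd (tensor X) w').
  apply: IHN => [a|]; last by rewrite /cycle linearB cz ddd subrr.
  rewrite leq_eqVlt => /orP[/eqP aN|Na].
    rewrite !ffunE; have := wP a; rewrite aN eqxx => ->.
    rewrite scalerA sgnK scale1r big1 ?addr0 ?subrr// => b _.
    have [->|/ff_mx_deg e] := eqVneq (ff_mx b a) 0; first by rewrite scale0r.
    have := wP b; rewrite e -aN ifF ?ffunE; first by move=> ->; rewrite scaler0.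
    by apply/eqP => /esym; apply: n_Sn.
  rewrite !ffunE zN// sub0r; have := wP a; rewrite gtn_eqF// => ->.
  rewrite linear0 scaler0 add0r big1 ?oppr0// => b _.
  have [->|/ff_mx_deg e] := eqVneq (ff_mx b a) 0; first by rewrite scale0r.
  have := wP b; rewrite e ifF ?ffunE; first by move=> ->; rewrite scaler0.
  by apply/eqP => e'; move: Na; rewrite -e' ltnNge leqnSn.
by exists (u + w'); rewrite linearD uE subrK.
Qed.

(** Together with [tensor_acyclic], this shows that tensoring preserves
    quasi-isomorphisms. *)
Lemma dcone_acyclic (X Y : dmod A) (s : dmap X Y) : dm_quasi_iso s ->
  forall z : dcone s, cycle z -> boundary z.
Proof.
move=> [inj sur] [y x]; rewrite /cycle /= /dcone_d /= => -[e1 e2].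
have cx : cycle x by rewrite /cycle -[LHS]opprK e2 oppr0.
have [|x0 x0E] := inj x cx.
  by exists (- y); rewrite linearN; apply/eqP; rewrite eqr_oppLR -addr_eq0 e1.
have [|c cc [e eE]] := sur (y + s x0).
  by rewrite /cycle linearD -dmf_d x0E.
exists (e, c - x0); rewrite /= /dcone_d /=; congr (_, _).
  by rewrite eE linearB /= addrA subrK addrK.
by rewrite linearB /= cc sub0r opprK.
Qed.

(** A primitive [(w1, w2)] of [(y, 0)] in the cone exhibits [y] as the sum of
    the image of [w2], up to signs a cycle, and the boundary of [w1]. *)
Lemma tensor_cone_exact (X Y : dmod A) (f : dmap X Y) (y : tensor Y) :
  cycle y -> boundary (tensor_map (dcone_in f) y) ->
  exists2 x : tensor X, cycle x & homologous y (tensor_map f x).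
Proof.
move=> cy [w wE].
pose w1 : tensor Y := [ffun a => (w a).1]; pose w2 : tensor X := [ffun a => (w a).2].
have sum1 (F : I -> (Y * X)%type) : (\sum_a F a).1 = \sum_a (F a).1.
  by rewrite (big_morph (fun z => z.1) (id1 := 0) (op1 := +%R)).
have sum2 (F : I -> (Y * X)%type) : (\sum_a F a).2 = \sum_a (F a).2.
  by rewrite (big_morph (fun z => z.2) (id1 := 0) (op1 := +%R)).
have w2d : dd (tensor X) (twist w2) = 0.
  rewrite /= /tensor_d act_twist; apply/ffunP => a; rewrite !ffunE linearZ /=.
  have /ffunP/(_ a)/(congr1 (fun z : dcone f => z.2)) := wE.
  rewrite !ffunE /= sum2 /= => /eqP; rewrite scalerN addrC subr_eq0 => /eqP e.
  rewrite -e -scalerBr -sumrB big1 ?scaler0// => b _.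
  by rewrite ffunE subrr.
exists (twist w2) => //; exists w1.
apply/ffunP => a; rewrite !ffunE /=.
have /ffunP/(_ a)/(congr1 (fun z : dcone f => z.1)) := wE.
rewrite !ffunE /= sum1 /= => <-; rewrite linearZ /= scalerDr.
rewrite addrAC addrK; congr (_ + _).
by apply: eq_bigr => b _; rewrite ffunE.
Qed.

Lemma tensor_quasi_iso (X Y : dmod A) (s : dmap X Y) :
  dm_quasi_iso s -> dm_quasi_iso (tensor_map s).
Proof.
move=> qs; have acC := tensor_acyclic (dcone_acyclic qs).
split=> [z cz [w wE]|y cy]; last first.
  have cy' : cycle (tensor_map (dcone_in s) y) by exact: cycle_map.
  by have [x cx yx] := tensor_cone_exact cy (acC _ cy'); exists x.
(* If [s z] is the boundary of [w], then [w] and [z] form a cycle of the cone;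
   a primitive of it has one of [z] as its second component. *)
pose c : tensor (dcone s) := [ffun a => (w a, - sgn a *: z a)].
have sum1 (F : I -> (Y * X)%type) : (\sum_a F a).1 = \sum_a (F a).1.
  by rewrite (big_morph (fun z => z.1) (id1 := 0) (op1 := +%R)).
have sum2 (F : I -> (Y * X)%type) : (\sum_a F a).2 = \sum_a (F a).2.
  by rewrite (big_morph (fun z => z.2) (id1 := 0) (op1 := +%R)).
have [|u uE] := acC c.
  apply/ffunP => a; rewrite !ffunE /= /dcone_d /=.
  rewrite [LHS]surjective_pairing /= sum1 sum2 /=; congr (_, _).
    have /ffunP/(_ a) := wE; rewrite !ffunE /= linearZ /= scalerDr scalerA.
    rewrite mulrN sgnK scaleN1r addrAC => <-.
    apply/eqP; rewrite subr_eq0; apply/eqP; congr (_ + _).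
    by apply: eq_bigr => b _; rewrite ffunE.
  have /ffunP/(_ a) := cz; rewrite !ffunE => e.
  rewrite linearZ /= scaleNr opprK.
  transitivity (sgn a *: (sgn a *: dd X (z a) + \sum_b ff_mx b a *: z b)).
    rewrite scalerDr; congr (_ + _); rewrite scaler_sumr; apply: eq_bigr => b _.
    rewrite ffunE /= !scalerA; congr (_ *: _).
    have [->|/ff_mx_deg eb] := eqVneq (ff_mx b a) 0; first by rewrite mul0r mulr0.
    by rewrite /sgn eb exprS; ring.
  by rewrite e scaler0.
pose u2 : tensor X := [ffun a => (u a).2].
exists (twist u2); rewrite /= /tensor_d act_twist; apply/ffunP => a; rewrite !ffunE.
have /ffunP/(_ a)/(congr1 (fun z : dcone s => z.2)) := uE.
rewrite !ffunE /= sum2 /= => e.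
rewrite linearZ /= -scalerBr.
transitivity (- sgn a *: (- sgn a *: z a)); last first.
  by rewrite scalerA mulrNN sgnK scale1r.
rewrite -e scaleNr -scalerN; congr (_ *: _); rewrite opprD scalerN opprK.
by congr (_ - _); apply: eq_bigr => b _; rewrite ffunE.
Qed.

End Tensor.

Section TensorRight.
Variables (A : comNzRingType) (P Q : ffcplx A) (t : ffmap P Q).

Lemma tensorr_d (X : dmod A) (z : tensor P X) :
  act t (dd (tensor P X) z) = dd (tensor Q X) (act t z).
Proof.
rewrite /= /tensor_d linearD /= !act_comp (eq_act _ (@fm_comm A P Q t)).
congr (_ + _); rewrite -act_pointwise; apply/ffunP => b; rewrite !ffunE scaler_sumr.
apply: eq_bigr => a _; rewrite !ffunE !scalerA; congr (_ *: _).
have [->|/fm_mx_deg e] := eqVneq (t a b) 0; first by rewrite mul0r mulr0.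
by rewrite /sgn e mulrC.
Qed.

Definition tensorr (X : dmod A) : dmap (tensor P X) (tensor Q X) :=
  @DMap A (tensor P X) (tensor Q X) (@act A X _ _ t) (@tensorr_d X).

Lemma tensorr_natural (X Y : dmod A) (f : dmap X Y) z :
  tensorr Y (tensor_map P f z) = tensor_map Q f (tensorr X z).
Proof. exact: act_pointwise. Qed.

End TensorRight.

(** * The ghost lemma *)


(** A functor from [C] to differential modules, which inverts [S] on homology
    and sends the triangles in [T] to cones.  Coproducts in the localization
    are defined by a universal property over all formal zigzags; the functorial
    direct sums of [C] serve to compare them with actual direct sums. *)
Record model (A : comNzRingType) (C : shCat)
    (S : forall X Y : C, hom X Y -> Prop)
    (T : forall X Y Z : C, hom X Y -> hom Y Z -> hom Z (sh 1 X) -> Prop) :=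
  Model {
  mod_ob :> C -> dmod A;
  mod_map : forall X Y, hom X Y -> dmap (mod_ob X) (mod_ob Y);
  mod_map_heq : forall X Y (f g : hom X Y),
    heq f g -> dhomotopic (mod_map f) (mod_map g);
  mod_map_id : forall X x, mod_map (idm X) x = x;
  mod_map_comp : forall X Y Z (g : hom Y Z) (f : hom X Y) x,
    mod_map (comp g f) x = mod_map g (mod_map f x);
  mod_map_S : forall X Y (s : hom X Y), S X Y s -> dm_quasi_iso (mod_map s);
  mod_ob_sh : forall n X,
    exists (i : dmap (mod_ob (sh n X)) (dm_shift n (mod_ob X)))
      (j : dmap (dm_shift n (mod_ob X)) (mod_ob (sh n X))), forall x, j (i x) = x;
  mod_map_tri : forall X Y Z u v w, T X Y Z u v w ->
    exists c : dmap (mod_ob Z) (dcone (mod_map u)),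
      forall y, c (mod_map v y) = dcone_in (mod_map u) y;
  mod_map_zero : forall X Y, exists o : hom X Y, forall x, mod_map o x = 0;
  biprod : C -> C -> C;
  biprod_in1 : forall X Y, hom X (biprod X Y);
  biprod_in2 : forall X Y, hom Y (biprod X Y);
  copair : forall X Y W, hom X W -> hom Y W -> hom (biprod X Y) W;
  copair_in1 : forall X Y W (f : hom X W) (g : hom Y W),
    heq (comp (copair f g) (biprod_in1 X Y)) f;
  copair_in2 : forall X Y W (f : hom X W) (g : hom Y W),
    heq (comp (copair f g) (biprod_in2 X Y)) g;
  copair_S : forall X X' Y (s : hom X X'), S X X' s ->
    S _ _ (copair (comp (biprod_in1 X' Y) s) (biprod_in2 X' Y));
  biprod_span : forall X Y, exists (p1 : dmap (mod_ob (biprod X Y)) (mod_ob X))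
    (p2 : dmap (mod_ob (biprod X Y)) (mod_ob Y)),
    forall z,
      z = mod_map (biprod_in1 X Y) (p1 z) + mod_map (biprod_in2 X Y) (p2 z)
}.

Section Model.
Variables (A : comNzRingType) (C : shCat)
  (S : forall X Y : C, hom X Y -> Prop)
  (S_sh : forall n X Y (s : hom X Y), S s -> S (shm n s))
  (T : forall X Y Z : C, hom X Y -> hom Y Z -> hom Z (sh 1 X) -> Prop)
  (G : model A S T).
Notation TC := (loc_tri S_sh T).

Section OnHomology.
Variable P : ffcplx A.
Notation G_ X := (tensor P (G X)).

(** The action of a formal zigzag on cycles, well defined up to boundaries. *)
Fixpoint locmap X Y (f : locHom S X Y) : G_ X -> G_ Y :=
  match f with
  | LocMor _ _ f => fun z => tensor_map P (mod_map G f) z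
  | LocInv X Y s _ => fun z =>
      xget 0 [set x : G_ X |
        cycle x /\ homologous z (tensor_map P (mod_map G s) x)]
  | LocComp _ _ _ g f => fun z => locmap g (locmap f z)
  end.

Lemma locinvP X Y (s : hom X Y) (Ss : S s) (z : G_ Y) : cycle z ->
  cycle (locmap (LocInv Ss) z) /\
  homologous z (tensor_map P (mod_map G s) (locmap (LocInv Ss) z)).
Proof.
move=> cz /=; have [_ sur] := tensor_quasi_iso P (mod_map_S G Ss).
by have [x cx zx] := sur z cz; case: xgetP => [y -> [? ?]|/(_ x)[]].
Qed.

Lemma S_inj X Y (s : hom X Y) (x : G_ X) : S s -> cycle x ->
  boundary (tensor_map P (mod_map G s) x) -> boundary x.
Proof.
by move=> Ss; have [inj _] := tensor_quasi_iso P (mod_map_S G Ss); apply: inj.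
Qed.

Lemma S_inj_homologous X Y (s : hom X Y) (x y : G_ X) : S s -> cycle x -> cycle y ->
  homologous (tensor_map P (mod_map G s) x) (tensor_map P (mod_map G s) y) ->
  homologous x y.
Proof.
move=> Ss cx cy; rewrite /homologous -linearB; apply: S_inj Ss _.
by rewrite /cycle linearB cx cy subrr.
Qed.

Lemma locmap_cycle X Y (f : locHom S X Y) (z : G_ X) : cycle z -> cycle (locmap f z).
Proof.
elim: f z => {X Y} [X Y f|X Y s Ss|X Y Z g IHg f IHf] z cz.
- exact: cycle_map.
- by have [] := locinvP Ss cz.
- by apply: IHg; apply: IHf.
Qed.

Lemma locmap_homologous X Y (f : locHom S X Y) (z z' : G_ X) :
  cycle z -> cycle z' -> homologous z z' -> homologous (locmap f z) (locmap f z').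
Proof.
elim: f z z' => {X Y} [X Y f|X Y s Ss|X Y Z g IHg f IHf] z z' cz cz' zz'.
- exact: homologous_map.
- have [c1 h1] := locinvP Ss cz; have [c2 h2] := locinvP Ss cz'.
  apply: (S_inj_homologous Ss) => //; apply: homologous_trans (homologous_sym h1) _.
  exact: homologous_trans h2.
- by apply: IHg; [apply: locmap_cycle..|apply: IHf].
Qed.

Lemma locmapD X Y (f : locHom S X Y) (z z' : G_ X) :
  cycle z -> cycle z' -> homologous (locmap f (z + z')) (locmap f z + locmap f z').
Proof.
elim: f z z' => {X Y} [X Y f|X Y s Ss|X Y Z g IHg f IHf] z z' cz cz'.
- by apply: homologous_eq; rewrite /= linearD.
- have [c1 h1] := locinvP Ss cz; have [c2 h2] := locinvP Ss cz'.
  have [c3 h3] := locinvP Ss (cycleD cz cz').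
  apply: (S_inj_homologous Ss) => //; first exact: cycleD.
  apply: homologous_trans (homologous_sym h3) _; rewrite linearD; exact: homologousD.
- apply: homologous_trans (IHg _ _ (locmap_cycle f cz) (locmap_cycle f cz')).
  apply: (locmap_homologous g); first exact/locmap_cycle/cycleD.
    by apply: cycleD; apply: locmap_cycle.
  exact: IHf.
Qed.

Lemma locmap_boundary X Y (f : locHom S X Y) (z : G_ X) :
  boundary z -> boundary (locmap f z).
Proof.
move=> bz; have cz := boundary_cycle bz.
have c0 : cycle (0 : G_ X) by rewrite /cycle linear0.
have h : homologous (locmap f z) (locmap f (z + z)).
  apply: locmap_homologous => //; first exact: cycleD.
  rewrite /homologous opprD addrA subrr sub0r.
  by case: bz => w <-; exists (- w); rewrite linearN.
have := homologous_trans h (locmapD f cz cz).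
rewrite /homologous opprD addrA subrr sub0r => -[w ww].
by exists (- w); rewrite linearN ww opprK.
Qed.

Lemma locmap_id X (z : G_ X) : locmap (LocMor S (idm X)) z = z.
Proof. by apply/ffunP => a; rewrite /= ffunE mod_map_id. Qed.

Lemma locmap_eq X Y (f g : locHom S X Y) (z : G_ X) :
  locEq f g -> cycle z -> homologous (locmap f z) (locmap g z).
Proof.
move=> fg; elim: fg z => {X Y f g}.
- by move=> *; apply: homologous_refl.
- by move=> X Y f g _ IH z cz; apply/homologous_sym/IH.
- by move=> X Y f g h _ IH1 _ IH2 z cz; apply: homologous_trans (IH1 _ cz) (IH2 _ cz).
- move=> X Y Z g g' f f' _ IHg _ IHf z cz /=.
  apply: homologous_trans (IHg _ (locmap_cycle f' cz)).
  by apply: locmap_homologous; [apply: locmap_cycle..|apply: IHf].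
- by move=> X Y f z cz; apply: homologous_eq; rewrite [LHS]locmap_id.
- move=> X Y f z cz; apply: homologous_eq; rewrite [LHS]/=.
  by rewrite -/(locmap (LocMor S (idm X)) z) locmap_id.
- by move=> W X Y Z h g f z cz; apply: homologous_refl.
- move=> X Y f g fg z cz; apply: tensor_homotopic => //; exact: mod_map_heq.
- move=> X Y Z g f z cz; apply: homologous_eq; apply/ffunP => a.
  by rewrite /= !ffunE mod_map_comp.
- move=> X Y s Ss z cz; rewrite locmap_id.
  have cs : cycle (tensor_map P (mod_map G s) z) by apply: cycle_map.
  have [c1 h1] := locinvP Ss cs.
  by apply: (S_inj_homologous Ss) => //; apply: homologous_sym.
- move=> X Y s Ss z cz; rewrite locmap_id.
  by have [c1 h1] := locinvP Ss cz; apply: homologous_sym.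
Qed.

End OnHomology.

Lemma locmap_natural (P Q : ffcplx A) (t : ffmap P Q) X Y (f : locHom S X Y) z :
  cycle z ->
  homologous (tensorr t (G Y) (locmap f z)) (locmap f (tensorr t (G X) z)).
Proof.
elim: f z => {X Y} [X Y f|X Y s Ss|X Y Z g IHg f IHf] z cz.
- by apply: homologous_eq; rewrite [LHS]tensorr_natural.
- have [c1 h1] := locinvP Ss cz.
  have [c2 h2] := locinvP Ss (cycle_map (tensorr t (G Y)) cz).
  apply: (S_inj_homologous Ss) => //; first exact: cycle_map.
  rewrite -tensorr_natural; apply: homologous_trans h2.
  by apply: homologous_map; apply: homologous_sym.
- apply: homologous_trans (IHg _ (locmap_cycle f cz)) _.
  apply: (locmap_homologous g); first exact/cycle_map/locmap_cycle.
    exact/locmap_cycle/cycle_map.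
  exact: IHf.
Qed.

Definition vanishes (P Q : ffcplx A) (t : ffmap P Q) (X : dmod A) :=
  forall z : tensor P X, cycle z -> boundary (tensorr t X z).

Section Closure.
Variables (P Q : ffcplx A) (t : ffmap P Q).

Lemma vanishes_retract (X Y : dmod A) (i : dmap X Y) (j : dmap Y X) :
  (forall x, j (i x) = x) -> vanishes t Y -> vanishes t X.
Proof.
move=> ji vY z cz; have := vY _ (cycle_map (tensor_map P i) cz).
rewrite tensorr_natural => /(boundary_map (tensor_map Q j)).
by congr (boundary _); apply/ffunP => a; rewrite !ffunE ji.
Qed.

(** Multiplying the component of degree [i] by the [i]-th power of the sign of
    the shift identifies the tensor product of the shift with the shift of the
    tensor product. *)
Lemma vanishes_shift n (X : dmod A) : vanishes t X -> vanishes t (dm_shift n X).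
Proof.
pose u : A := (-1) ^+ `|n|%N; have uu : u * u = 1 by rewrite /u -expr2 sqrr_sign.
pose E (R : ffcplx A) (z : {ffun ff_ix R -> X}) : {ffun ff_ix R -> X} :=
  [ffun a => u ^+ ff_deg a *: z a].
have uX k : u ^+ k * u ^+ k = 1 by rewrite -exprMn uu expr1n.
have EK R z : E R (E R z) = z.
  by apply/ffunP => a; rewrite !ffunE scalerA uX scale1r.
have Ed R z : E R (dd (tensor R (dm_shift n X)) z) = u *: dd (tensor R X) (E R z).
  apply/ffunP => a; rewrite !ffunE !scalerDr -/u; congr (_ + _).
    have -> : dd (dm_shift n X) (z a) = u *: dd X (z a) by [].
    rewrite [dd X (_ *: z a)]linearZ /= !scalerA; congr (_ *: _); ring.
  rewrite !scaler_sumr; apply: eq_bigr => b _; rewrite ffunE !scalerA.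
  congr (_ *: _); have [->|/ff_mx_deg e] := eqVneq (ff_mx b a) 0.
    by rewrite !(mulr0, mul0r).
  rewrite e exprS; transitivity (u * u * (u ^+ ff_deg a * ff_mx b a)); last by ring.
  by rewrite uu mul1r.
have Et z : E Q (tensorr t X z) = tensorr t X (E P z).
  apply/ffunP => a; rewrite !ffunE !scaler_sumr; apply: eq_bigr => b _.
  rewrite ffunE !scalerA; congr (_ *: _).
  have [->|/fm_mx_deg e] := eqVneq (t b a) 0; first by rewrite mulr0 mul0r.
  by rewrite e mulrC.
move=> vX z cz; have [|w ww] := vX (E P z).
  have := Ed P z; rewrite cz => /(congr1 (fun x => u *: x)).
  rewrite scalerA uu scale1r /cycle => <-.
  by apply/ffunP => a; rewrite !ffunE !scaler0.
exists (u *: E Q w); rewrite -[LHS]EK Ed.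
rewrite -[RHS]EK [in RHS]Et -ww; congr (E Q _).
have -> : E Q (u *: E Q w) = u *: w.
  rewrite -[in RHS](EK Q w); apply/ffunP => a; rewrite !ffunE !scalerA.
  by congr (_ *: _); ring.
by rewrite linearZ scalerA uu scale1r.
Qed.

(** Direct sums with [Y] extend to formal zigzags, because they preserve
    [S]. *)
Lemma loc_extend X X' Y (f : locHom S X X') :
  exists h : locHom S (biprod G X Y) (biprod G X' Y),
    locEq (LocComp h (LocMor S (biprod_in1 G X Y)))
      (LocComp (LocMor S (biprod_in1 G X' Y)) f) /\
    locEq (LocComp h (LocMor S (biprod_in2 G X Y)))
      (LocMor S (biprod_in2 G X' Y)).
Proof.
elim: f => {X X'} [X X' f|X X' s Ss|X X' X'' g [h' [h'1 h'2]] f [h [h1 h2]]].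
- exists (LocMor S (copair G (comp (biprod_in1 G X' Y) f) (biprod_in2 G X' Y))); split.
    apply: LocTrans (LocSym (LocMorComp _ _ _)) _.
    apply: LocTrans (LocMorComp _ _ _); apply: LocHeq; exact: copair_in1.
  apply: LocTrans (LocSym (LocMorComp _ _ _)) _.
  by apply: LocHeq; apply: copair_in2.
- pose s' := copair G (comp (biprod_in1 G X' Y) s) (biprod_in2 G X' Y).
  have Ss' : S s' by apply: copair_S.
  have e1 : locEq (LocComp (LocMor S s') (LocMor S (biprod_in1 G X Y)))
      (LocComp (LocMor S (biprod_in1 G X' Y)) (LocMor S s)).
    apply: LocTrans (LocSym (LocMorComp _ _ _)) _.
    apply: LocTrans (LocMorComp _ _ _); apply: LocHeq; exact: copair_in1.
  have e2 : locEq (LocComp (LocMor S s') (LocMor S (biprod_in2 G X Y)))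
      (LocMor S (biprod_in2 G X' Y)).
    apply: LocTrans (LocSym (LocMorComp _ _ _)) _.
    by apply: LocHeq; apply: copair_in2.
  exists (LocInv Ss'); split.
    (* Cancel [s'] on the left and [s] on the right in [e1]. *)
    apply: LocTrans (LocTrans (LocCongr (LocRefl _) (LocSym (LocIdr _))) _) _.
    exact: LocRefl.
    apply: LocTrans
      (LocCongr (LocRefl _) (LocCongr (LocRefl _) (LocSym (LocInvr Ss)))) _.
    apply: LocTrans (LocCongr (LocRefl _) (LocA _ _ _)) _.
    apply: LocTrans (LocCongr (LocRefl _) (LocCongr (LocSym e1) (LocRefl _))) _.
    apply: LocTrans (LocA _ _ _) _; apply: LocCongr (LocRefl _).
    apply: LocTrans (LocA _ _ _) _.
    apply: LocTrans (LocCongr (LocInvl _) (LocRefl _)) _.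
    exact: LocIdl.
  apply: LocTrans (LocCongr (LocRefl _) (LocSym e2)) _.
  apply: LocTrans (LocA _ _ _) _.
  apply: LocTrans (LocCongr (LocInvl _) (LocRefl _)) _.
  exact: LocIdl.
- exists (LocComp h' h); split.
    apply: LocTrans (LocSym (LocA _ _ _)) _.
    apply: LocTrans (LocCongr (LocRefl _) h1) _.
    apply: LocTrans (LocA _ _ _) _.
    apply: LocTrans (LocCongr h'1 (LocRefl _)) _.
    exact: LocSym (LocA _ _ _).
  apply: LocTrans (LocSym (LocA _ _ _)) _.
  by apply: LocTrans (LocCongr (LocRefl _) h2) _.
Qed.

Lemma loc_mor_copair X Y W (f : hom X W) (g : hom Y W) :
  locEq (LocComp (LocMor S (copair G f g)) (LocMor S (biprod_in1 G X Y)))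
    (LocMor S f) /\
  locEq (LocComp (LocMor S (copair G f g)) (LocMor S (biprod_in2 G X Y)))
    (LocMor S g).
Proof.
split; apply: LocTrans (LocSym (LocMorComp _ _ _)) _; apply: LocHeq.
  exact: copair_in1.
exact: copair_in2.
Qed.

(** The map [X + Y -> W + Y -> Y + W -> W + W -> W], where the sums are those
    of [C]. *)
Lemma loc_copair X Y W (f : locHom S X W) (g : locHom S Y W) :
  exists h : locHom S (biprod G X Y) W,
    locEq (LocComp h (LocMor S (biprod_in1 G X Y))) f /\
    locEq (LocComp h (LocMor S (biprod_in2 G X Y))) g.
Proof.
have [f' [f1 f2]] := loc_extend Y f; have [g' [g1 g2]] := loc_extend W g.
have [s1 s2] := loc_mor_copair (biprod_in2 G Y W) (biprod_in1 G Y W).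
have [t1 t2] := loc_mor_copair (idm W) (idm W).
pose swap := LocMor S (copair G (biprod_in2 G Y W) (biprod_in1 G Y W)).
pose fold := LocMor S (copair G (idm W) (idm W)).
exists (LocComp fold (LocComp g' (LocComp swap f'))).
have pull V (k : locHom S V (biprod G X Y)) :
    locEq (LocComp (LocComp fold (LocComp g' (LocComp swap f'))) k)
      (LocComp fold (LocComp g' (LocComp swap (LocComp f' k)))).
  apply: LocTrans (LocSym (LocA _ _ _)) _; apply: LocCongr (LocRefl _) _.
  apply: LocTrans (LocSym (LocA _ _ _)) _; apply: LocCongr (LocRefl _) _.
  exact: LocSym (LocA _ _ _).
split; apply: LocTrans (pull _ _) _.
  have e : locEq (LocComp g' (LocComp swap
      (LocComp f' (LocMor S (biprod_in1 G X Y)))))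
      (LocComp (LocMor S (biprod_in2 G W W)) f).
    apply: LocTrans (LocCongr (LocRefl _) (LocCongr (LocRefl _) f1)) _.
    apply: LocTrans (LocCongr (LocRefl _) (LocA _ _ _)) _.
    apply: LocTrans (LocCongr (LocRefl _) (LocCongr s1 (LocRefl _))) _.
    by apply: LocTrans (LocA _ _ _) _; apply: LocCongr (LocRefl _).
  apply: LocTrans (LocCongr (LocRefl _) e) _.
  apply: LocTrans (LocA _ _ _) _.
  by apply: LocTrans (LocCongr t2 (LocRefl _)) _; apply: LocIdl.
have e : locEq (LocComp g' (LocComp swap
    (LocComp f' (LocMor S (biprod_in2 G X Y)))))
    (LocComp (LocMor S (biprod_in1 G W W)) g).
  apply: LocTrans (LocCongr (LocRefl _) (LocCongr (LocRefl _) f2)) _.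
  by apply: LocTrans (LocCongr (LocRefl _) s2) _.
apply: LocTrans (LocCongr (LocRefl _) e) _.
apply: LocTrans (LocA _ _ _) _.
by apply: LocTrans (LocCongr t1 (LocRefl _)) _; apply: LocIdl.
Qed.

(** A coproduct [Z] of [X] and [Y] in the localization is a retract of their
    direct sum in [C], by [loc_copair] and the uniqueness in the universal
    property; a zero object has its identity equal to a zero map. *)
Lemma vanishes_closure (I : TC -> Prop) (X : TC) :
  (forall X, I X -> vanishes t (G X)) -> add_closure I X -> vanishes t (G X).
Proof.
move=> vI; elim=> {X} [X /vI //|Z [ini _]|X Y Z dsZ _ vX _ vY|X Y Z dsZ _ vZ|n X _ vX].
- move=> z cz; have [f uniq] := ini Z; have [o oE] := mod_map_zero G Z Z.
  have e : locEq (LocMor S (@idm C Z)) (LocMor S o).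
    exact: LocTrans (uniq (LocMor S (@idm C Z))) (LocSym (uniq (LocMor S o))).
  have := locmap_eq e (cycle_map (tensorr t (G Z)) cz).
  rewrite locmap_id /= => h; apply: boundary_homologous h _.
  exists 0; rewrite linear0; apply/ffunP => a; rewrite !ffunE oE//.
- move: dsZ => [iX [iY univ]] z cz.
  have [h [[h1 h2] _]] :=
    univ _ (LocMor S (biprod_in1 G X Y)) (LocMor S (biprod_in2 G X Y)).
  have [k [k1 k2]] := loc_copair iX iY.
  have [e [[e1 e2] uniq]] := univ Z iX iY.
  have kh : locEq (LocComp k h) (LocMor S (@idm C Z)).
    apply: LocTrans (uniq _ _ _) (LocSym (uniq _ _ _)).
    + apply: LocTrans (LocSym (LocA _ _ _)) _.
      exact: LocTrans (LocCongr (LocRefl _) h1) _.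
    + apply: LocTrans (LocSym (LocA _ _ _)) _.
      exact: LocTrans (LocCongr (LocRefl _) h2) _.
    + exact: LocIdl.
    + exact: LocIdl.
  have := locmap_eq kh (cycle_map (tensorr t (G Z)) cz).
  rewrite locmap_id /= => /homologous_sym hz; apply: boundary_homologous hz _.
  apply: locmap_boundary.
  apply: boundary_homologous (homologous_sym (locmap_natural t h cz)) _.
  have := locmap_cycle h cz; move: (locmap h z) => y cy.
  have [p1 [p2 pE]] := biprod_span G X Y.
  have -> : y = tensor_map P (mod_map G (biprod_in1 G X Y)) (tensor_map P p1 y) +
      tensor_map P (mod_map G (biprod_in2 G X Y)) (tensor_map P p2 y).
    by apply/ffunP => a; rewrite !ffunE -pE.
  rewrite linearD; apply: boundaryD; rewrite tensorr_natural; apply: boundary_map.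
    by apply: vX; apply: cycle_map.
  by apply: vY; apply: cycle_map.
- move: dsZ => [iX [iY univ]] z cz; have [o _] := mod_map_zero G Y X.
  have [h [[h1 _] _]] := univ _ (LocMor S (@idm C X)) (LocMor S o).
  have := locmap_eq h1 (cycle_map (tensorr t (G X)) cz).
  rewrite locmap_id /= => /homologous_sym hz; apply: boundary_homologous hz _.
  apply: locmap_boundary.
  apply: boundary_homologous (homologous_sym (locmap_natural t iX cz)) _.
  by apply: vZ; apply: locmap_cycle.
- have [i [j ji]] := mod_ob_sh G n X.
  by apply: vanishes_retract ji _; apply: vanishes_shift.
Qed.

End Closure.

(** The composite is an argument of the second constructor, so that explicit
    matrices can be recognized as composites. *)
Inductive ghosts (I : dmod A -> Prop) : nat -> forall P Q, ffmap P Q -> Prop :=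
| Ghosts0 P (t : ffmap P P) : (forall X, tensorr t X =1 id) -> ghosts I 0 t
| GhostsS i P Q R (t : ffmap P Q) (s : ffmap Q R) (st : ffmap P R) :
    (forall X, I X -> vanishes t X) -> ghosts I i s ->
    (forall X z, tensorr st X z = tensorr s X (tensorr t X z)) ->
    ghosts I i.+1 st.

(** After applying [t], a class on [M] dies on [M2], so it comes from [M1],
    where [s] kills it. *)
Lemma vanishes_star (I J : TC -> Prop) P Q R (t : ffmap P Q) (s : ffmap Q R)
    (st : ffmap P R) (M : TC) :
    (forall X, I X -> vanishes s (G X)) -> (forall X, J X -> vanishes t (G X)) ->
    (forall X z, tensorr st X z = tensorr s X (tensorr t X z)) ->
  star I J M -> vanishes st (G M).
Proof.
move=> vI vJ stE [M1 [M2 [u [v [w [/vI v1 /vJ v2]]]]]].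
move=> [X' [Y' [Z' [u' [v' [w' [Tri [a [b [c [[ia ib ic] [eu ev _]]]]]]]]]]]] z cz.
have [a' [_ aa']] := ia; have [b' [b'b _]] := ib.
have [c0 c0E] := mod_map_tri G Tri.
rewrite stE; set y := tensorr t (G M) z.
have cy : cycle y by exact: cycle_map.
have bv : boundary (locmap v y).
  apply: boundary_homologous (homologous_sym (locmap_natural t v cz)) _.
  by apply: v2; apply: locmap_cycle.
have cby := locmap_cycle b cy.
have [x' cx' hx'] : exists2 x' : tensor Q (G X'), cycle x' &
    homologous (locmap b y) (tensor_map Q (mod_map G u') x').
  apply: tensor_cone_exact => //.
  have : boundary (tensor_map Q (mod_map G v') (locmap b y)).
    have := locmap_eq ev cy => /= h; apply: boundary_homologous (homologous_sym h) _.
    exact: locmap_boundary.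
  move=> /(boundary_map (tensor_map Q c0)).
  by congr (boundary _); apply/ffunP => i; rewrite !ffunE c0E.
pose x := locmap a' x'; have cx : cycle x by apply: locmap_cycle.
have hy : homologous y (locmap u x).
  have h1 := locmap_eq b'b cy; rewrite [in X in homologous _ X]locmap_id in h1.
  apply: homologous_trans (homologous_sym h1) _ => /=.
  have h2 := locmap_eq b'b (locmap_cycle u cx).
  rewrite [in X in homologous _ X]locmap_id in h2.
  apply: homologous_trans _ h2 => /=; apply: locmap_homologous => //.
    exact/locmap_cycle/locmap_cycle.
  apply: homologous_trans hx' _; apply: homologous_sym.
  apply: homologous_trans (locmap_eq eu cx) _.
  apply: (homologous_map (tensor_map Q (mod_map G u'))).
  by have := locmap_eq aa' cx'; rewrite locmap_id.
have cux := locmap_cycle u cx.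
apply: boundary_homologous (homologous_map (tensorr s (G M)) hy) _.
apply: boundary_homologous (locmap_natural s u cx) _.
by apply: locmap_boundary; apply: v1.
Qed.

(** By induction along [gen]; each step uses up one map of the composite, by
    [vanishes_star].  The generators are compared with objects of [I'] because
    the two models present the module [A] differently. *)
Lemma ghost_lemma (I : TC -> Prop) (I' : dmod A -> Prop) i (X : TC)
    P Q (t : ffmap P Q) :
  (forall P Q (t : ffmap P Q), (forall X, I' X -> vanishes t X) ->
    forall X, I X -> vanishes t (G X)) ->
  ghosts I' i t -> gen I i X -> vanishes t (G X).
Proof.
move=> II' gt; elim: gt X => {i P Q t} [P t tE|i P Q R t s st vt _ IH stE] X /=.
  move=> zX; have : add_closure (fun _ : TC => False) X by apply: add_zero.
  by apply: vanishes_closure.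
apply: vanishes_closure => M; apply: vanishes_star stE => [Y|Y]; first exact: IH.
by apply: vanishes_closure => Z; apply: II'.
Qed.

End Model.

(** * Differential modules attached to the two categories *)


Section DmModel.
Variable A : comNzRingType.
Implicit Types X Y W : dmod A.

(** A projective differential module is contractible: the cone of its identity
    maps onto its shift, and a section of this map is a null-homotopy. *)
Lemma projective_contractible (P : dmod A) : projective P ->
  exists h : {linear P -> P}, forall x, x = dd P (h x) + h (dd P x).
Proof.
move=> /(@projective_shift A 1 P) pP.
have dfl : deflation (dcone_pr (dmap_id P)).
  have lin : linear (fun x : P => (0, x) : dcone (dmap_id P)).
    by move=> a x y; congr (_, _); rewrite /= scaler0 addr0.
  pose mix := GRing.isLinear.Build A P (dcone (dmap_id P)) *:%R _ lin.
  pose s : {linear P -> dcone (dmap_id P)} :=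
    HB.pack (fun x : P => (0, x) : dcone (dmap_id P)) mix.
  by exists s.
have [g gE] := pP _ _ _ dfl (dmap_id (dm_shift 1 P)).
have lin : linear (fun x : P => - (g x).1).
  by move=> a x y; rewrite linearP /= opprD scalerN.
pose mix := GRing.isLinear.Build A P P *:%R _ lin.
pose h : {linear P -> P} := HB.pack (fun x : P => - (g x).1) mix.
exists h => x; rewrite /= linearN.
have := congr1 fst (dmf_d g x); rewrite /= expr1 scaleN1r linearN /= => e.
have := gE x; rewrite /= /dcone_prr => e2; rewrite e2 in e.
by rewrite e addrA addNr add0r.
Qed.

Lemma stably_eq_homotopic X Y (f g : dmap X Y) : stably_eq f g -> dhomotopic f g.
Proof.
move=> [P /projective_contractible[h hE] [a [b fg]]].
exists (b \o h \o a) => x; rewrite fg /= [in LHS](hE (a x)) linearD /=.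
by rewrite dmf_d dmf_d.
Qed.

Definition dm_in1 X Y : dmap X (dmod_sum X Y) :=
  sval (cid (dmap_pair (dmap_id X) (dmap0 X Y))).
Definition dm_in2 X Y : dmap Y (dmod_sum X Y) :=
  sval (cid (dmap_pair (dmap0 Y X) (dmap_id Y))).
Definition dm_copair X Y W (f : dmap X W) (g : dmap Y W) : dmap (dmod_sum X Y) W :=
  sval (cid (dmap_copair f g)).

Lemma dm_in1E X Y x : dm_in1 X Y x = (x, 0).
Proof. exact: svalP (cid (dmap_pair (dmap_id X) (dmap0 X Y))) x. Qed.

Lemma dm_in2E X Y y : dm_in2 X Y y = (0, y).
Proof. exact: svalP (cid (dmap_pair (dmap0 Y X) (dmap_id Y))) y. Qed.

Lemma dm_copairE X Y W (f : dmap X W) (g : dmap Y W) z :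
  dm_copair f g z = f z.1 + g z.2.
Proof. exact: svalP (cid (dmap_copair f g)) z. Qed.

Lemma dm_extend_quasi_iso X X' Y (s : dmap X X') : dm_quasi_iso s ->
  dm_quasi_iso (dm_copair (dmap_comp (dm_in1 X' Y) s) (dm_in2 X' Y)).
Proof.
move=> [inj sur].
have E z : dm_copair (dmap_comp (dm_in1 X' Y) s) (dm_in2 X' Y) z = (s z.1, z.2).
  rewrite dm_copairE /= dm_in1E dm_in2E; congr (_, _); rewrite /= ?addr0 ?add0r//.
split=> [[x y] [cx cy]|[x' y] [cx' cy]].
  rewrite E => -[[u v] [/= eu ev]].
  have [|w we] := inj x cx; first by exists u.
  by exists (w, v); rewrite /= /dmod_sum_d /= we ev.
have [x cx [w wE]] := sur x' cx'; exists (x, y).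
  by rewrite /cycle /= /dmod_sum_d /= cx cy.
by exists (w, 0); rewrite E /= /dmod_sum_d /= wE linear0 -[0 in LHS](subrr y).
Qed.

Definition dm_model :
  @model A (dm_homotopy_cat A) (@dm_quasi_iso A) (@dcone_triangle A).
Proof.
apply: (@Model A (dm_homotopy_cat A) (@dm_quasi_iso A) (@dcone_triangle A)
  id (fun X Y f => f) _ _ _ _ _ _ _ (@dmod_sum A) dm_in1 dm_in2 dm_copair).
- exact: stably_eq_homotopic.
- by [].
- by [].
- by [].
- by move=> n X; exists (dmap_id _), (dmap_id _).
- by move=> ? ? ? ? ? ? [X Y f]; exists (dmap_id _).
- by move=> X Y; exists (dmap0 X Y).
- move=> X Y W f g; apply: stably_eq_eq => x /=.
  by rewrite dm_copairE dm_in1E /= linear0 addr0.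
- move=> X Y W f g; apply: stably_eq_eq => x /=.
  by rewrite dm_copairE dm_in2E /= linear0 add0r.
- by move=> X X' Y s; apply: dm_extend_quasi_iso.
- move=> X Y.
  have lin1 : linear (fun z : dmod_sum X Y => z.1) by [].
  have lin2 : linear (fun z : dmod_sum X Y => z.2) by [].
  pose m1 := GRing.isLinear.Build A (dmod_sum X Y) X *:%R _ lin1.
  pose m2 := GRing.isLinear.Build A (dmod_sum X Y) Y *:%R _ lin2.
  pose p1 : {linear dmod_sum X Y -> X} := HB.pack (fun z : dmod_sum X Y => z.1) m1.
  pose p2 : {linear dmod_sum X Y -> Y} := HB.pack (fun z : dmod_sum X Y => z.2) m2.
  have d1 x : p1 (dd (dmod_sum X Y) x) = dd X (p1 x) by [].
  have d2 x : p2 (dd (dmod_sum X Y) x) = dd Y (p2 x) by [].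
  exists (DMap d1), (DMap d2) => -[x y]; rewrite dm_in1E dm_in2E.
  by congr (_, _); rewrite /= ?addr0 ?add0r.
Defined.

End DmModel.

Section Tot.
Variable A : comNzRingType.
Implicit Types X Y W : cplx A.

(** The product totalization.  It is exact, and unlike the sum it has plain
    families as elements. *)
Definition tot_car X : Type := forall i : int, X i.

HB.instance Definition _ X := gen_eqMixin (tot_car X).
HB.instance Definition _ X := gen_choiceMixin (tot_car X).

Section TotObj.
Variable X : cplx A.

Definition tot_add (x y : tot_car X) : tot_car X := fun i => x i + y i.
Definition tot_opp (x : tot_car X) : tot_car X := fun i => - x i.
Definition tot_zero : tot_car X := fun i => 0.
Definition tot_scale (a : A) (x : tot_car X) : tot_car X := fun i => a *: x i.

Lemma tot_ext (x y : tot_car X) : (forall i, x i = y i) -> x = y.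
Proof. exact: functional_extensionality_dep. Qed.

Fact tot_addA : associative tot_add.
Proof. by move=> x y z; apply: tot_ext => i; apply: addrA. Qed.
Fact tot_addC : commutative tot_add.
Proof. by move=> x y; apply: tot_ext => i; apply: addrC. Qed.
Fact tot_add0 : left_id tot_zero tot_add.
Proof. by move=> x; apply: tot_ext => i; apply: add0r. Qed.
Fact tot_addN : left_inverse tot_zero tot_opp tot_add.
Proof. by move=> x; apply: tot_ext => i; apply: addNr. Qed.

HB.instance Definition _ :=
  GRing.isZmodule.Build (tot_car X) tot_addA tot_addC tot_add0 tot_addN.

Fact tot_scaleA a b x : tot_scale a (tot_scale b x) = tot_scale (a * b) x.
Proof. by apply: tot_ext => i; apply: scalerA. Qed.
Fact tot_scale1 : left_id 1 tot_scale.
Proof. by move=> x; apply: tot_ext => i; apply: scale1r. Qed.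
Fact tot_scaleDr : right_distributive tot_scale +%R.
Proof. by move=> a x y; apply: tot_ext => i; apply: scalerDr. Qed.
Fact tot_scaleDl x : {morph tot_scale^~ x : a b / a + b}.
Proof. by move=> a b; apply: tot_ext => i; apply: scalerDl. Qed.

HB.instance Definition _ := GRing.Zmodule_isLmodule.Build A (tot_car X)
  tot_scaleA tot_scale1 tot_scaleDr tot_scaleDl.

Definition tot_d (x : tot_car X) : tot_car X := fun i => cd X (i - 1) i (x (i - 1)).

Fact tot_d_linear : linear tot_d.
Proof. by move=> a x y; apply: tot_ext => i; apply: linearP. Qed.

HB.instance Definition _ :=
  GRing.isLinear.Build A (tot_car X) (tot_car X) *:%R tot_d tot_d_linear.

Definition tot : dmod A.
Proof. by exists (tot_car X) tot_d => x; apply: tot_ext => i; apply: cdd. Defined.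

Lemma cd_next i j (x : X i) : (j = i + 1 -> cd X i j x = 0) -> cd X i j x = 0.
Proof.
move=> h; have [e|/eqP ne] := eqVneq j (i + 1); first exact: h.
by apply: cd_shape => e; apply: ne.
Qed.

Lemma tot_cycle (x : tot) : cycle x <-> forall i, cocycle (x i).
Proof.
split=> [cx i j|cx]; last by apply: tot_ext => i; apply: cx.
apply: cd_next => e; have /(congr1 (fun z : tot_car X => z j)) := cx.
by rewrite /= /tot_d; have -> : j - 1 = i by rewrite e addrK.
Qed.

Lemma coboundary_next i (x : X (i + 1)) : coboundary x ->
  exists y, cd X i (i + 1) y = x.
Proof.
move=> [j [y yE]]; have [e|/eqP ne] := eqVneq j i; first by subst j; exists y.
by exists 0; rewrite linear0 -yE cd_shape// => /addIr.
Qed.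

Lemma tot_boundary (x : tot) : boundary x <-> forall i, coboundary (x i).
Proof.
split=> [[y <-] i|bx]; first by exists (i - 1), (y (i - 1)).
pose y i := sval (cid (coboundary_next (bx (i + 1)))).
have yE i : cd X i (i + 1) (y i) = x (i + 1).
  exact: svalP (cid (coboundary_next (bx (i + 1)))).
exists y; apply: tot_ext => i; rewrite /= /tot_d.
have := yE (i - 1); move: (y (i - 1)) => z.
by rewrite subrK.
Qed.

Lemma transp_cd i j i' j' (x : X i) : i = i' -> j = j' ->
  transp j' (cd X i j x) = cd X i' j' (transp i' x).
Proof. by move=> ei ej; subst i' j'; rewrite !transp_id. Qed.

End TotObj.

Section TotMap.
Variables X Y : cplx A.

Lemma transp_map (f : cmap X Y) i j (x : X i) : i = j ->
  transp j (f i x) = f j (transp j x).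
Proof. by move=> e; subst j; rewrite !transp_id. Qed.

Definition tot_fun (f : cmap X Y) (x : tot_car X) : tot_car Y := fun i => f i (x i).

Fact tot_fun_linear f : linear (tot_fun f).
Proof. by move=> a x y; apply: tot_ext => i; apply: linearP. Qed.

HB.instance Definition _ f :=
  GRing.isLinear.Build A (tot_car X) (tot_car Y) *:%R (tot_fun f) (tot_fun_linear f).

Fact tot_fun_d f (x : tot X) : tot_fun f (dd (tot X) x) = dd (tot Y) (tot_fun f x).
Proof. by apply: tot_ext => i; apply: cm_d. Qed.

Definition tot_map (f : cmap X Y) : dmap (tot X) (tot Y) :=
  @DMap A (tot X) (tot Y) (tot_fun f : {linear tot_car X -> tot_car Y})
    (tot_fun_d f).

Lemma tot_homotopic (f g : cmap X Y) :
  homotopic f g -> dhomotopic (tot_map f) (tot_map g).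
Proof.
move=> [h fg].
pose H (x : tot X) : tot Y := fun i => h (i + 1) i (x (i + 1)).
have lin : linear H by move=> a x y; apply: tot_ext => i; apply: linearP.
pose mix := GRing.isLinear.Build A (tot X) (tot Y) *:%R _ lin.
pose Hl : {linear tot X -> tot Y} := HB.pack H mix.
exists Hl => x; apply: tot_ext => i.
change (f i (x i) - g i (x i) =
  cd Y (i - 1) i (h (i - 1 + 1) (i - 1) (x (i - 1 + 1))) +
  h (i + 1) i (cd X (i + 1 - 1) (i + 1) (x (i + 1 - 1)))).
rewrite (fg i (i - 1) (i + 1)) ?subrK//; congr (_ + _).
by rewrite addrK.
Qed.

Lemma tot_quasi_iso (f : cmap X Y) : cx_quasi_iso f -> dm_quasi_iso (tot_map f).
Proof.
move=> qf; split=> [x /tot_cycle cx /tot_boundary bx|y /tot_cycle cy].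
  apply/tot_boundary => i; have [inj _] := qf i.
  by apply: inj; [apply: cx | apply: bx].
have ex i : exists x : X i, cocycle x /\ coboundary (y i - f i x).
  by have [_ sur] := qf i; have [x cx bx] := sur _ (cy i); exists x.
exists (fun i => sval (cid (ex i))).
  by apply/tot_cycle => i; have [] := svalP (cid (ex i)).
by apply/tot_boundary => i; have [] := svalP (cid (ex i)).
Qed.

End TotMap.

Lemma tot_shift n X : exists (i : dmap (tot (cx_shift n X)) (dm_shift n (tot X)))
  (j : dmap (dm_shift n (tot X)) (tot (cx_shift n X))), forall x, j (i x) = x.
Proof.
pose I (x : tot (cx_shift n X)) : tot X :=
  fun k => transp (X := X) k (x (k - n) : X (k - n + n)).
pose J (x : tot X) : tot (cx_shift n X) := fun k => x (k + n).
have linI : linear I.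
  by move=> a x y; apply: tot_ext => k; apply: transp_linear.
have linJ : linear J by move=> a x y; apply: tot_ext.
pose mI :=
  GRing.isLinear.Build A (tot (cx_shift n X)) (dm_shift n (tot X)) *:%R _ linI.
pose mJ :=
  GRing.isLinear.Build A (dm_shift n (tot X)) (tot (cx_shift n X)) *:%R _ linJ.
pose Il : {linear tot (cx_shift n X) -> dm_shift n (tot X)} := HB.pack I mI.
pose Jl : {linear dm_shift n (tot X) -> tot (cx_shift n X)} := HB.pack J mJ.
have dI x : Il (dd (tot (cx_shift n X)) x) = dd (dm_shift n (tot X)) (Il x).
  apply: tot_ext => k.
  change (transp (X := X) k
      ((-1) ^+ `|n|%N *: cd X (k - n - 1 + n) (k - n + n) (x (k - n - 1))) =
    (-1) ^+ `|n|%N *: cd X (k - 1) k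
      (transp (X := X) (k - 1) (x (k - 1 - n) : X (k - 1 - n + n)))).
  rewrite linearZ /=; congr (_ *: _).
  rewrite (@transp_cd X _ _ (k - 1) k) ?subrK//; last by rewrite addrAC subrK.
  by have -> : k - n - 1 = k - 1 - n by rewrite addrAC.
have dJ x : Jl (dd (dm_shift n (tot X)) x) = dd (tot (cx_shift n X)) (Jl x).
  apply: tot_ext => k.
  change ((-1) ^+ `|n|%N *: cd X (k + n - 1) (k + n) (x (k + n - 1)) =
    (-1) ^+ `|n|%N *: cd X (k - 1 + n) (k + n) (x (k - 1 + n))).
  by have -> : k + n - 1 = k - 1 + n by rewrite addrAC.
exists (DMap dI), (DMap dJ) => x; apply: tot_ext => k.
change (transp (X := X) (k + n) (x (k + n - n) : X (k + n - n + n)) = x k).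
have -> : k + n - n = k by rewrite addrK.
exact: transp_id.
Qed.

Lemma tot_cone X Y (f : cmap X Y) :
  exists c : dmap (tot (cone f)) (dcone (tot_map f)),
    forall y, c (tot_map (cone_in f) y) = dcone_in (tot_map f) y.
Proof.
pose c (z : tot (cone f)) : dcone (tot_map f) :=
  ((fun i => (z i).1) : tot_car Y,
   (fun i => transp (X := X) i (z (i - 1)).2) : tot_car X).
have lin : linear c.
  move=> a x y; congr (_, _); apply: tot_ext => i //.
  exact: transp_linear.
pose mix := GRing.isLinear.Build A (tot (cone f)) (dcone (tot_map f)) *:%R _ lin.
pose cl : {linear tot (cone f) -> dcone (tot_map f)} := HB.pack c mix.
have dc x : cl (dd (tot (cone f)) x) = dd (dcone (tot_map f)) (cl x).
  congr (_, _); apply: tot_ext => i.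
    change (cd Y (i - 1) i (x (i - 1)).1 + transp i (f (i - 1 + 1) (x (i - 1)).2) =
      cd Y (i - 1) i (x (i - 1)).1 + f i (transp (X := X) i (x (i - 1)).2)).
    by rewrite transp_map ?subrK.
  change (transp (X := X) i (- cd X (i - 1 - 1 + 1) (i - 1 + 1) (x (i - 1 - 1)).2) =
    - cd X (i - 1) i (transp (X := X) (i - 1) (x (i - 1 - 1)).2)).
  by rewrite linearN; congr (- _); apply: transp_cd; rewrite subrK.
exists (DMap dc) => y; congr (_, _); apply: tot_ext => i.
exact: linear0.
Qed.

Section CxSum.
Variables X Y : cplx A.

Definition cx_sum_d i j (z : X i * Y i) : X j * Y j := (cd X i j z.1, cd Y i j z.2).

Fact cx_sum_d_linear i j : linear (@cx_sum_d i j).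
Proof. by move=> a x y; rewrite /cx_sum_d !linearP. Qed.

HB.instance Definition _ i j :=
  GRing.isLinear.Build A (X i * Y i)%type (X j * Y j)%type *:%R (@cx_sum_d i j)
    (@cx_sum_d_linear i j).

Definition cx_sum : cplx A.
Proof.
exists (fun i => (X i * Y i)%type) (fun i j => @cx_sum_d i j).
- by move=> i j ij x /=; rewrite /cx_sum_d !cd_shape.
- by move=> i j k x /=; rewrite /cx_sum_d !cdd.
Defined.

Definition cx_in1_fun i (x : X i) : cx_sum i := (x, 0).
Definition cx_in2_fun i (y : Y i) : cx_sum i := (0, y).

Fact cx_in1_linear i : linear (@cx_in1_fun i).
Proof. by move=> a x y; congr (_, _); rewrite /= scaler0 addr0. Qed.
Fact cx_in2_linear i : linear (@cx_in2_fun i).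
Proof. by move=> a x y; congr (_, _); rewrite /= scaler0 addr0. Qed.

HB.instance Definition _ i :=
  GRing.isLinear.Build A (X i) (cx_sum i) *:%R (@cx_in1_fun i) (@cx_in1_linear i).
HB.instance Definition _ i :=
  GRing.isLinear.Build A (Y i) (cx_sum i) *:%R (@cx_in2_fun i) (@cx_in2_linear i).

Definition cx_in1 : cmap X cx_sum.
Proof.
by exists (fun i => @cx_in1_fun i) => i j x; congr (_, _); rewrite /= linear0.
Defined.

Definition cx_in2 : cmap Y cx_sum.
Proof.
by exists (fun i => @cx_in2_fun i) => i j x; congr (_, _); rewrite /= linear0.
Defined.

Definition cx_copair_fun W (f : cmap X W) (g : cmap Y W) i (z : cx_sum i) : W i :=
  f i z.1 + g i z.2.

Fact cx_copair_linear W (f : cmap X W) (g : cmap Y W) i :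
  linear (@cx_copair_fun W f g i).
Proof. by move=> a x y; rewrite /cx_copair_fun !linearP /= scalerDr addrACA. Qed.

HB.instance Definition _ W (f : cmap X W) (g : cmap Y W) i :=
  GRing.isLinear.Build A (cx_sum i) (W i) *:%R (@cx_copair_fun W f g i)
    (@cx_copair_linear W f g i).

Definition cx_copair W (f : cmap X W) (g : cmap Y W) : cmap cx_sum W.
Proof.
exists (fun i => @cx_copair_fun W f g i) => i j z.
by rewrite /= /cx_copair_fun /= !cm_d linearD.
Defined.

End CxSum.

Lemma coboundary_prev X i (x : X i) :
  coboundary x -> exists y, cd X (i - 1) i y = x.
Proof.
move=> [j [y yE]]; have [e|/eqP ne] := eqVneq j (i - 1).
  by subst j; exists y.
by exists 0; rewrite linear0 -yE cd_shape// => e; apply: ne; rewrite -e addrK.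
Qed.

Lemma cx_extend_quasi_iso X X' Y (s : cmap X X') : cx_quasi_iso s ->
  cx_quasi_iso (cx_copair (cm_comp (cx_in1 X' Y) s) (cx_in2 X' Y)).
Proof.
move=> qs i; have [inj sur] := qs i.
have E z : cx_copair (cm_comp (cx_in1 X' Y) s) (cx_in2 X' Y) i z = (s i z.1, z.2).
  by congr (_, _); rewrite /= ?addr0 ?add0r.
split=> [[x y] cxy|[x' y] cxy].
  have cx : cocycle x by move=> j; have [] := cxy j.
  rewrite E => /coboundary_prev[[u v] [/= eu ev]].
  have [|w we] := coboundary_prev (inj x cx _); first by exists (i - 1), u.
  by exists (i - 1), (w, v); rewrite /= /cx_sum_d /= we ev.
have cx' : cocycle x' by move=> j; have [] := cxy j.
have cy : cocycle y by move=> j; have [] := cxy j.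
have [x cx [j [w wE]]] := sur x' cx'; exists (x, y).
  by move=> k; rewrite /= /cx_sum_d /= cx cy.
by exists j, (w, 0); rewrite E /= /cx_sum_d /= wE linear0 -[0 in LHS](subrr y).
Qed.

Definition cm_zero X Y : cmap X Y.
Proof. by exists (fun i => \0) => i j x /=; rewrite linear0. Defined.

Definition cx_model :
  @model A (cx_homotopy_cat A) (@cx_quasi_iso A) (@cone_triangle A).
Proof.
apply: (@Model A (cx_homotopy_cat A) (@cx_quasi_iso A) (@cone_triangle A)
  tot (fun X Y f => tot_map f) _ _ _ _ _ _ _ cx_sum cx_in1 cx_in2 cx_copair).
- exact: tot_homotopic.
- by [].
- by [].
- exact: tot_quasi_iso.
- exact: tot_shift.
- by move=> ? ? ? ? ? ? [X Y f]; apply: tot_cone.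
- by move=> X Y; exists (cm_zero X Y).
- move=> X Y W f g; apply: homotopic_eq => i x /=.
  by rewrite /cx_copair_fun /= linear0 addr0.
- move=> X Y W f g; apply: homotopic_eq => i x /=.
  by rewrite /cx_copair_fun /= linear0 add0r.
- by move=> X X' Y s; apply: cx_extend_quasi_iso.
- move=> X Y.
  pose p1 (z : tot (cx_sum X Y)) : tot X := fun i => (z i).1.
  pose p2 (z : tot (cx_sum X Y)) : tot Y := fun i => (z i).2.
  have lin1 : linear p1 by [].
  have lin2 : linear p2 by [].
  pose m1 := GRing.isLinear.Build A (tot (cx_sum X Y)) (tot X) *:%R _ lin1.
  pose m2 := GRing.isLinear.Build A (tot (cx_sum X Y)) (tot Y) *:%R _ lin2.
  pose q1 : {linear tot (cx_sum X Y) -> tot X} := HB.pack p1 m1.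
  pose q2 : {linear tot (cx_sum X Y) -> tot Y} := HB.pack p2 m2.
  have d1 x : q1 (dd (tot (cx_sum X Y)) x) = dd (tot X) (q1 x) by [].
  have d2 x : q2 (dd (tot (cx_sum X Y)) x) = dd (tot Y) (q2 x) by [].
  exists (DMap d1), (DMap d2) => z; apply: tot_ext => i.
  change (z i = ((z i).1 + 0, 0 + (z i).2)).
  by rewrite addr0 add0r -surjective_pairing.
Defined.

End Tot.

(** * Truncations of the resolution *)


Section Window.
Variables (A : comNzRingType) (n : nat -> nat).
Variable d : forall i, 'M[A]_(rk n i.+1, rk n i).
Hypothesis dd0 : forall i, d i.+1 *m d i = 0.

(** The differential and the identity of the resolution as matrices indexed by
    all pairs of degrees, which absorbs equalities between degrees. *)
Definition res_d p q : 'M[A]_(rk n p, rk n q) :=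
  if p =P q.+1 is ReflectT e then castmx (congr1 (rk n) (esym e), erefl) (d q)
  else 0.

Definition res_id p q : 'M[A]_(rk n p, rk n q) :=
  if p =P q is ReflectT e then castmx (erefl, congr1 (rk n) e) 1%:M else 0.

Lemma res_dE q : res_d q.+1 q = d q.
Proof. by rewrite /res_d; case: eqP => // e; rewrite castmx_id. Qed.

Lemma res_d0 p q : p != q.+1 -> res_d p q = 0.
Proof. by rewrite /res_d; case: eqP. Qed.

Lemma res_idE q : res_id q q = 1%:M.
Proof. by rewrite /res_id; case: eqP => // e; rewrite castmx_id. Qed.

Lemma res_id0 p q : p != q -> res_id p q = 0.
Proof. by rewrite /res_id; case: eqP. Qed.

Lemma res_d_d p q s : res_d p q *m res_d q s = 0.
Proof.
have [->|/res_d0->] := eqVneq p q.+1; last by rewrite mul0mx.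
have [->|/res_d0->] := eqVneq q s.+1; last by rewrite mulmx0.
by rewrite !res_dE dd0.
Qed.

Lemma res_id_l p q k (M : forall q, 'M[A]_(rk n q, k)) :
  res_id p q *m M q = if p == q then M p else 0.
Proof.
have [->|/res_id0->] := eqVneq p q; last by rewrite mul0mx.
by rewrite res_idE mul1mx.
Qed.

Lemma res_id_r p q k (M : forall p, 'M[A]_(k, rk n p)) :
  M p *m res_id p q = if p == q then M q else 0.
Proof.
have [->|/res_id0->] := eqVneq p q; last by rewrite mulmx0.
by rewrite res_idE mulmx1.
Qed.

Variable r : nat.

Definition win_ix j : finType := {i : 'I_r.+1 & 'I_(rk n (j + i))}.
Definition win_deg j (t : win_ix j) := (j + tag t)%N.
Definition win_mx j (t u : win_ix j) : A :=
  res_d (win_deg t) (win_deg u) (tagged t) (tagged u).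

Definition win_el j (i : 'I_r.+1) (a : 'I_(rk n (j + i))) : win_ix j :=
  Tagged (fun i : 'I_r.+1 => 'I_(rk n (j + i))) a.

Lemma sum_win (V : nmodType) j (F : win_ix j -> V) :
  \sum_t F t = \sum_i \sum_a F (@win_el j i a).
Proof.
rewrite (sig_big_dep _ _ (fun i a => F (@win_el j i a))).
by apply: eq_bigr => -[].
Qed.

Lemma sum_window (V : nmodType) j p (x : V) :
  \sum_(i < r.+1) (if p == (j + i)%N then x else 0) =
  if (j <= p <= j + r)%N then x else 0.
Proof.
case: ifP => [/andP[jp pjr]|w].
  have pr : (p - j < r.+1)%N by rewrite ltnS leq_subLR.
  rewrite (bigD1 (Ordinal pr))//= subnKC// eqxx big1 ?addr0// => i ni.
  by case: eqP => // e; case/eqP: ni; apply: val_inj; rewrite /= e addKn.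
rewrite big1// => i _; case: eqP => // e.
by move: w; rewrite e leq_addr leq_add2l -ltnS ltn_ord.
Qed.

Fact win_mx_deg j (t u : win_ix j) :
  win_mx t u != 0 -> win_deg t = (win_deg u).+1.
Proof.
rewrite /win_mx; case: (eqVneq (win_deg t) (win_deg u).+1) => // /res_d0->.
by rewrite mxE eqxx.
Qed.

Fact win_mxK j (t u : win_ix j) : \sum_s win_mx t s * win_mx s u = 0.
Proof.
rewrite sum_win big1// => i _.
transitivity ((res_d (win_deg t) (j + i) *m res_d (j + i) (win_deg u))
  (tagged t) (tagged u)).
  by rewrite mxE.
by rewrite res_d_d mxE.
Qed.

(** The brutal truncation of the resolution to the degrees from [j] to
    [j + r].  Homology in the top degree is harmless, because the window moves
    with [j]. *)
Definition window j : ffcplx A := FFCplx (@win_mx_deg j) (@win_mxK j).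

Section Shift.
Variables (j j' : nat) (jj' : (j <= j')%N).

Definition shift_mx (t : win_ix j) (u : win_ix j') : A :=
  res_id (win_deg t) (win_deg u) (tagged t) (tagged u).

Fact shift_deg t u : shift_mx t u != 0 -> win_deg t = win_deg u.
Proof.
rewrite /shift_mx; case: (eqVneq (win_deg t) (win_deg u)) => // /res_id0->.
by rewrite mxE eqxx.
Qed.

Lemma win_degP l (t : win_ix l) : (l <= win_deg t <= l + r)%N.
Proof. by rewrite leq_addr leq_add2l -ltnS ltn_ord. Qed.

Fact shift_comm t v :
  \sum_u shift_mx t u * win_mx u v = \sum_s win_mx t s * shift_mx s v.
Proof.
rewrite !sum_win.
transitivity (\sum_(i < r.+1) if win_deg t == (j' + i)%N then
    res_d (win_deg t) (win_deg v) (tagged t) (tagged v) else 0).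
  apply: eq_bigr => i _.
  have := res_id_l (win_deg t) (j' + i) (fun q => res_d q (win_deg v)).
  move/(congr1 (fun M : 'M_(_, _) => M (tagged t) (tagged v))).
  by rewrite mxE => ->; case: ifP; rewrite ?mxE.
transitivity (\sum_(i < r.+1) if win_deg v == (j + i)%N then
    res_d (win_deg t) (win_deg v) (tagged t) (tagged v) else 0); last first.
  apply: eq_bigr => i _.
  have := res_id_r (j + i) (win_deg v) (res_d (win_deg t)).
  move/(congr1 (fun M : 'M_(_, _) => M (tagged t) (tagged v))).
  by rewrite mxE eq_sym => ->; case: ifP; rewrite ?mxE.
rewrite !sum_window.
have [e|/res_d0->] := eqVneq (win_deg t) (win_deg v).+1; last first.
  by rewrite mxE !if_same.
have /andP[jt tj] := win_degP t; have /andP[jv vj] := win_degP v.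
rewrite !ifT//; apply/andP; split.
- exact: leq_trans jv.
- by apply: leq_trans tj; rewrite e.
- by rewrite e; apply: leqW.
- by apply: leq_trans tj _; rewrite leq_add2r.
Qed.

Definition win_shift : ffmap (window j) (window j') :=
  @FFMap A (window j) (window j') shift_mx shift_deg shift_comm.

End Shift.

Hypothesis d_exact : forall i (v : 'rV_(rk n i.+1)),
  v *m d i = 0 -> exists w : 'rV_(rk n i.+2), v = w *m d i.+1.

Lemma res_d_exact p q (v : 'rV_(rk n p)) : p = q.+1 -> v *m res_d p q = 0 ->
  exists w : 'rV_(rk n p.+1), v = w *m res_d p.+1 p.
Proof.
move=> e; subst p; rewrite res_dE => /d_exact[w ->]; exists w.
by rewrite res_dE.
Qed.

(** A cycle of [window j] is killed because its component of degree [j] is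
    dropped, and its components of higher degree are boundaries in the
    resolution, which the new component of degree [j + r + 1] makes
    available. *)
Lemma win_shift_ghost j : vanishes (win_shift (leqnSn j)) (dm_triv A^o).
Proof.
move=> z cz.
pose v (i : 'I_r.+1) : 'rV[A]_(rk n (j + i)) :=
  \row_a z (win_el a).
have mulE (p : 'I_r.+1) q (M : 'M[A]_(rk n (j + p), q)) b :
    \sum_a M a b *: (z (win_el a) : A^o) =
    (v p *m M) 0 b.
  by rewrite mxE; apply: eq_bigr => a _; rewrite mxE mulrC.
have exw (i : 'I_r.+1) : exists w : 'rV_(rk n (j + i).+1),
    if i == ord0 then w = 0 else v i = w *m res_d (j + i).+1 (j + i).
  have [_|ni] := eqVneq i ord0; first by exists 0.
  have i0 : (0 < i)%N by rewrite lt0n; apply: contra ni => /eqP e; apply/eqP/val_inj.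
  have pi : (i.-1 < r.+1)%N by apply: leq_trans (ltn_ord i); rewrite ltnS leq_pred.
  pose i' := Ordinal pi.
  have ii' : (j + i = (j + i').+1)%N by rewrite /= -addnS prednK.
  apply: (res_d_exact ii'); apply/rowP => b; rewrite [RHS]mxE.
  have /ffunP/(_ (win_el b)) := cz.
  rewrite !ffunE scaler0 add0r sum_win (bigD1 i)//= [X in _ + X]big1 ?addr0.
    by move=> e; rewrite -mulE; apply: e.
  move=> k nk; rewrite big1// => a _.
  have -> : win_mx (win_el a)
      (win_el b) = 0.
    rewrite /win_mx res_d0 ?mxE//; apply: contra nk => /eqP.
    by rewrite /win_deg/= -addnS prednK// => /addnI/val_inj->.
  by rewrite scale0r.
pose w i := sval (cid (exw i)).
(* [(j + i).+1] is convertible to [j.+1 + i], so that [w i] is a component of an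
   element of the next window. *)
have wE i : if i == ord0 then w i = 0 else v i = w i *m res_d (j + i).+1 (j + i).
  exact: svalP (cid (exw i)).
exists [ffun t : win_ix j.+1 => w (tag t) 0 (tagged t)].
apply/ffunP => u; rewrite !ffunE scaler0 add0r !sum_win; apply: eq_bigr => i _.
transitivity ((v i *m res_id (j + i) (win_deg u)) 0 (tagged u)).
  2: by rewrite -mulE.
transitivity ((w i *m res_d (j + i).+1 (win_deg u)) 0 (tagged u)).
  by rewrite mxE; apply: eq_bigr => a _; rewrite ffunE mulrC.
have := wE i; case: eqP => [-> ->|_ ->].
  rewrite mul0mx !mxE big1// => a _; rewrite res_id0 ?mxE ?mulr0//.
  by rewrite /win_deg addn0 -[X in X != _]addn0 addSnnS eqn_add2l.
rewrite -mulmxA; congr ((_ *m _) 0 _).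
rewrite (res_id_r _ _ (res_d (j + i).+1)); case: eqP => // /eqP ne.
by rewrite res_d0// eqSS.
Qed.

Lemma win_shift_ghosts l j j' (jj' : (j <= j')%N) : j' = (j + l)%N ->
  ghosts (fun X => X = dm_triv A^o) l (win_shift jj').
Proof.
elim: l j jj' => [|l IHl] j jj' e.
  rewrite addn0 in e; subst j'; apply: Ghosts0 => X z; apply/ffunP => u.
  rewrite !ffunE sum_win.
  rewrite (bigD1 (tag u))//= [X in _ + X]big1 ?addr0; last first.
    move=> i ni; rewrite big1// => a _; rewrite /shift_mx res_id0 ?mxE ?scale0r//.
    by apply: contra ni => /eqP/addnI/val_inj/= ->.
  rewrite (bigD1 (tagged u))//= big1 ?addr0.
    by rewrite /shift_mx /win_deg /= res_idE mxE eqxx scale1r; case: u.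
  by move=> a /negPf na; rewrite /shift_mx /win_deg /= res_idE mxE na scale0r.
have j1 : (j.+1 <= j')%N by rewrite e addnS ltnS leq_addr.
apply: (GhostsS (t := win_shift (leqnSn j)) (s := win_shift j1)).
- by move=> X ->; apply: win_shift_ghost.
- by apply: IHl; rewrite e addSnnS.
move=> X z; rewrite /= act_comp; apply: eq_act => t u; rewrite sum_win.
transitivity (\sum_(i < r.+1) if win_deg t == (j.+1 + i)%N then
    shift_mx t u else 0); last first.
  apply: eq_bigr => i _.
  have := res_id_l (win_deg t) (j.+1 + i) (fun q => res_id q (win_deg u)).
  move/(congr1 (fun M : 'M_(_, _) => M (tagged t) (tagged u))).
  by rewrite mxE => ->; case: ifP; rewrite ?mxE.
rewrite sum_window /shift_mx.
have [e'|/res_id0->] := eqVneq (win_deg t) (win_deg u); last by rewrite mxE if_same.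
rewrite ifT//; have /andP[jt tj] := win_degP t; have /andP[ju uj] := win_degP u.
apply/andP; split; first by rewrite e'; apply: leq_trans ju.
by apply: leq_trans tj _; rewrite addSn leqnSn.
Qed.

End Window.

Section Residue.
Variables (A : comNzRingType) (m : idealr A).
Local Open Scope quotient_scope.

Definition res_pi (a : A) : residue m := \pi_({ideal_quot m}) a.

Lemma res_pi_eq0 a : (res_pi a == 0) = (a \in m).
Proof.
have -> : (0 : residue m) = res_pi 0 by rewrite /res_pi !piE.
by rewrite -[in RHS](subr0 a) Quotient.idealrBE.
Qed.

Lemma res_piM a b : a *: res_pi b = res_pi (a * b).
Proof. exact: (esym (Quotient.pi_mul m a b)). Qed.

Lemma res_pi_sum (I : finType) (F : I -> A) :
  \sum_i res_pi (F i) = res_pi (\sum_i F i).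
Proof.
rewrite (big_morph res_pi (id1 := 0) (op1 := +%R))//.
  by move=> a b; rewrite /res_pi; exact: (Quotient.pi_add m a b).
by rewrite /res_pi piE.
Qed.

Lemma res_scale0 a (x : residue m) : a \in m -> a *: x = 0.
Proof.
move=> ma; rewrite -[x]reprK -/(res_pi _) res_piM; apply/eqP.
by rewrite res_pi_eq0 mulrC; apply: idealMr.
Qed.

End Residue.

(** * Non-vanishing on the residue field *)

Section Stalk.
Variables (A : comNzRingType) (M : lmodType A).

Definition stalk_in_fun (x : M) : tot_car (stalk M) :=
  fun i => match i == 0 as b return (if b then M else 'rV[A]_0 : lmodType A) with
           | true => x | false => 0 end.

Definition stalk_out_fun (z : tot_car (stalk M)) : M := z 0.

Fact stalk_in_linear : linear stalk_in_fun.
Proof.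
move=> a x y; apply: tot_ext => i; change (stalk_in_fun (a *: x + y) i =
  a *: stalk_in_fun x i + stalk_in_fun y i).
by rewrite /stalk_in_fun /=; case: (i == 0) => //; rewrite scaler0 addr0.
Qed.

Fact stalk_out_linear : linear stalk_out_fun.
Proof. by []. Qed.

HB.instance Definition _ :=
  GRing.isLinear.Build A M (tot_car (stalk M)) *:%R stalk_in_fun stalk_in_linear.
HB.instance Definition _ :=
  GRing.isLinear.Build A (tot_car (stalk M)) M *:%R stalk_out_fun stalk_out_linear.

Fact stalk_in_d (x : dm_triv M) :
  stalk_in_fun (dd (dm_triv M) x) = dd (tot (stalk M)) (stalk_in_fun x).
Proof. by rewrite /= linear0; apply: tot_ext. Qed.

Fact stalk_out_d (z : tot (stalk M)) :
  stalk_out_fun (dd (tot (stalk M)) z) = dd (dm_triv M) (stalk_out_fun z).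
Proof. by []. Qed.

Definition stalk_in : dmap (dm_triv M) (tot (stalk M)) :=
  @DMap A (dm_triv M) (tot (stalk M))
    (stalk_in_fun : {linear M -> tot_car (stalk M)}) stalk_in_d.

Definition stalk_out : dmap (tot (stalk M)) (dm_triv M) :=
  @DMap A (tot (stalk M)) (dm_triv M)
    (stalk_out_fun : {linear tot_car (stalk M) -> M}) stalk_out_d.

Lemma stalk_inK x : stalk_out (stalk_in x) = x.
Proof. by []. Qed.

Lemma stalk_outK z : stalk_in (stalk_out z) = z.
Proof.
by apply: tot_ext => -[[|k]|k] //; apply: esym; exact: thinmx0.
Qed.

End Stalk.

Lemma chain_below_sub (A : comNzRingType) (J P Q : A -> Prop) r :
  isprime Q -> subideal P Q -> chain_below J r P -> chain_below J r Q.
Proof.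
move=> pQ PQ; case: r => [|r] [pP].
  by move=> JP; split=> // x /JP/PQ.
move=> [R [RP NPR chR]]; split=> //; exists R; split=> // [x /RP/PQ//|QR].
by apply: NPR => x /PQ/QR.
Qed.

Lemma prime_chain_below (A : comNzRingType) (m : idealr A) r :
    noetherian A -> local_ring m -> prime_chain A r ->
  chain_below (fun a => a = 0) r (fun x => x \in m).
Proof.
move=> noethA localA [p pP].
have pr i : isprime (fun x => x \in p i).
  split; [exact: isideal_idealr|by rewrite idealr1|].
  by move=> x y; rewrite prime_idealrM => /orP.
suff ch k (kr : (k < r.+1)%N) :
    chain_below (fun a => a = 0) k (fun x => x \in p (Ordinal kr)).
  apply: chain_below_sub (ch r (ltnSn r)); first exact: max_prime.
  move=> x px; apply: (proper_sub_max noethA localA (isideal_idealr _)) px.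
  by rewrite idealr1.
elim: k kr => [|k IHk] kr; first by split=> // _ ->; exact: idealr0.
have kr' := ltnW kr; split=> //; exists (fun x => x \in p (Ordinal kr')).
have [s1 s2] := pP (Ordinal kr') (Ordinal kr) (ltnSn k).
by split.
Qed.

(** The differentials of the resolution act as zero on the residue field, so
    the class of [z] is not zero in the first window, and it is kept by the map
    to the last one. *)
Lemma residue_not_vanishes (A : comNzRingType) (m : idealr A) (n : nat -> nat)
    (d : forall i, 'M[A]_(rk n i.+1, rk n i)) (dd0 : forall i, d i.+1 *m d i = 0)
    (dm : forall i a b, d i a b \in m) r (z : 'rV[A]_(rk n r)) b :
  z 0 b \notin m ->
  ~ vanishes (win_shift dd0 r (leq0n r)) (dm_triv (residue m)).
Proof.
move=> zb van.
have dm' p q a c : res_d d p q a c \in m.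
  have [e|/res_d0->] := eqVneq p q.+1; last by rewrite mxE idealr0.
  by subst p; rewrite res_dE.
pose zeta : tensor (window dd0 r 0) (dm_triv (residue m)) :=
  [ffun t => res_pi m ((z *m res_id A n r (win_deg t)) 0 (tagged t))].
have d0 (j : nat) (x : tensor (window dd0 r j) (dm_triv (residue m))) :
    dd (tensor (window dd0 r j) (dm_triv (residue m))) x = 0.
  apply/ffunP => u; rewrite !ffunE scaler0 add0r big1// => t _.
  by apply: res_scale0; apply: dm'.
have [w] := van zeta (d0 _ _); rewrite d0 => /ffunP e.
pose b' : 'I_(rk n (r + 0)) := cast_ord (congr1 (rk n) (esym (addn0 r))) b.
have := e (@win_el n r r ord0 b'); rewrite !ffunE sum_win.
have -> : \sum_i \sum_a shift_mx A (@win_el n r 0 i a) (@win_el n r r ord0 b') *: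
    zeta (@win_el n r 0 i a) =
    res_pi m (\sum_(i < r.+1) (z *m res_id A n r (0 + i) *m
      res_id A n (0 + i) (r + 0)) 0 b').
  rewrite -res_pi_sum; apply: eq_bigr => i _; rewrite [X in res_pi _ X]mxE.
  rewrite -res_pi_sum; apply: eq_bigr => a _.
  by rewrite ffunE res_piM mulrC.
move=> /esym/eqP; rewrite res_pi_eq0.
have -> : \sum_(i < r.+1) (z *m res_id A n r (0 + i) *m
      res_id A n (0 + i) (r + 0)) 0 b' =
    \sum_(i < r.+1) if r == (0 + i)%N then z 0 b else 0.
  apply: eq_bigr => i _; rewrite -mulmxA.
  rewrite (res_id_l r (0 + i) (fun q => res_id A n q (r + 0))).
  case: eqP => _; last by rewrite mulmx0 mxE.
  rewrite {}/b'; move: (r + 0)%N (addn0 r) => q e0; subst q.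
  by rewrite res_idE mulmx1; congr (z 0 _); apply: val_inj.
by rewrite sum_window leq0n add0n leqnn /=; apply/negP.
Qed.

Theorem proposition7p14 (k : fieldType) (A : comAlgType k) (m : idealr A)
    (noethA : noetherian A) (localA : local_ring m) :
  ~ gen (T := derived_cat A) (fun X => X = stalk A^o) (krull_dim A)
      (stalk (residue m)) /\
  ~ gen (T := Ddiff A) (fun X => X = dm_triv A^o) (krull_dim A)
      (dm_triv (residue m)).
Proof.
have [n [d [d0P d_exact d_min]]] := minimal_resolution noethA localA.
have rn : (krull_dim A <= n 0%N)%N.
  rewrite /krull_dim; case: xgetP => [r _ [ch _]|_]; last exact: leq0n.
  have := prime_chain_below noethA localA ch.
  apply: (height_le noethA (x := fun l => d 0%N l 0)).
    by move=> l; apply: (res_entries d0P d_exact d_min).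
  move=> a /d0P[w ->]; exists (fun l => w 0 l).
  by rewrite mxE.
move: (krull_dim A) rn => r rn.
have [z [b zb]] := res_nonzero d0P d_exact d_min rn.
have dd0 := res_dd d_exact.
have d_exact' i (v : 'rV_(rk n i.+1)) : v *m d i = 0 ->
    exists w : 'rV_(rk n i.+2), v = w *m d i.+1 by move/d_exact.
have nv := residue_not_vanishes (dd0 := dd0) (res_entries d0P d_exact d_min) zb.
have gh := win_shift_ghosts dd0 r d_exact' (leq0n r) (esym (add0n r)).
split=> [g|g]; apply: nv.
  apply: (vanishes_retract (@stalk_inK A _)).
  apply: (ghost_lemma (G := cx_model A) _ gh g) => P Q t vt X ->.
  by apply: (vanishes_retract (@stalk_outK A _)); apply: vt.
by apply: (ghost_lemma (G := dm_model A) _ gh g) => P Q t vt X ->; apply: vt.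
Qed.
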